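(* For all simplicial sets $X$, $Y$, $Z$, the operators $H_{X\times Y,Z}$ and $H_{X,Y\times Z}$ on $C(X\times Y\times Z)$ commute in the graded sense: $$H_{X\times Y,Z}\,H_{X,Y\times Z}=-H_{X,Y\times Z}\,H_{X\times Y,Z}.$$
   Context: $\Bbbk$ is a commutative ring with unit; $C(X)$ is the normalized chain complex of a simplicial set $X$ over $\Bbbk$. For a simplex $x$ write $\partial_p^qx=\partial_p\partial_{p+1}\cdots\partial_qx$ for $p\le q$ and $\partial_p^{p-1}x=x$. For a set $\alpha=\{\alpha_1<\dots<\alpha_p\}$ of non-negative integers write $s_\alpha x=s_{\alpha_p}\cdots s_{\alpha_1}x$, $s_\emptyset x=x$, and $\alpha+m=\{\alpha_1+m,\dots,\alpha_p+m\}$. A $(p,q)$-shuffle $(\alpha,\beta)\vdash(p,q)$ is a partition of $\{0,\dots,p+q-1\}$ into sets $\alpha,\beta$ of sizes $p,q$; $(-1)^{(\alpha,\beta)}$ is the sign of the permutation $(\alpha_1<\dots<\alpha_p,\beta_1<\dots<\beta_q)$. The Eilenberg--Mac Lane homotopy $H_{X,Y}\colon C(X\times Y)\to C(X\times Y)$ (degree $+1$) is, for $(x,y)\in X_n\times Y_n$ and with $m=n-p-q$, $$H(x,y)=\sum_{p,q\ge0,\;p+q<n}\ \sum_{(\alpha,\beta)\vdash(p+1,q)}(-1)^{m+1+(\alpha,\beta)}\bigl(s_{\beta+m}\,s_{m-1}\,\partial_{n-q+1}^nx,\ s_{\alpha+m}\,\partial_m^{n-q-1}y\bigr).$$ $H_{X\times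 Y,Z}$ and $H_{X,Y\times Z}$ arise from regarding $X\times Y\times Z$ as $(X\times Y)\times Z$ and $X\times(Y\times Z)$, respectively. *)

(* Defs.v *)
From HB Require Import structures.
From mathcomp Require Import all_boot all_order all_fingroup all_algebra.
From mathcomp Require Import generic_quotient ring_quotient zify finmap.
From mathcomp.classical Require Import boolp.
From mathcomp.multinomials Require Import monalg.
From Stdlib Require Import Eqdep_dec.

Set Implicit Arguments.
Unset Strict Implicit.
Unset Printing Implicit Defensive.

Import GRing.Theory.
Local Open Scope ring_scope.
Local Open Scope quotient_scope.

(* The operators are indexed by nat; [face n i] is meaningful for           *)
(* [i <= n.+1] and [degen n i] for [i <= n], and nothing is assumed about   *)
(* (nor ever applied to) other indices.  Requiring a choiceType in each     *)
(* degree is no restriction in the presence of classical choice.            *)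
Record sset := SSet {
  simplex :> nat -> choiceType;
  face : forall n : nat, nat -> simplex n.+1 -> simplex n;
  degen : forall n : nat, nat -> simplex n -> simplex n.+1;
  face_face : forall n i j (x : simplex n.+2), (i < j <= n.+2)%N ->
    face i (face j x) = face j.-1 (face i x);
  face_degen_lt : forall n i j (x : simplex n.+1), (i < j <= n.+1)%N ->
    face i (degen j x) = degen j.-1 (face i x);
  face_degen_id : forall n j (x : simplex n), (j <= n)%N ->
    face j (degen j x) = x;
  face_degen_succ : forall n j (x : simplex n), (j <= n)%N ->
    face j.+1 (degen j x) = x;
  face_degen_gt : forall n i j (x : simplex n.+1), (j.+1 < i <= n.+2)%N ->
    face i (degen j x) = degen j (face i.-1 x);
  degen_degen : forall n i j (x : simplex n), (i <= j <= n)%N ->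
    degen i (degen j x) = degen j.+1 (degen i x)
}.

Arguments face {s n} i x.
Arguments degen {s n} i x.

Record smap (X Y : sset) := SMap {
  smap_fun :> forall n, X n -> Y n;
  smap_face : forall n i (x : X n.+1), (i <= n.+1)%N ->
    smap_fun (face i x) = face i (smap_fun x);
  smap_degen : forall n i (x : X n), (i <= n)%N ->
    smap_fun (degen i x) = degen i (smap_fun x)
}.

Section Product.
Variables X Y : sset.

Definition sprod_face n i (u : (X n.+1 * Y n.+1)%type) : (X n * Y n)%type :=
  (face i u.1, face i u.2).
Definition sprod_degen n i (u : (X n * Y n)%type) : (X n.+1 * Y n.+1)%type :=
  (degen i u.1, degen i u.2).

Definition sprod : sset.
Proof.
refine (@SSet (fun n => (X n * Y n)%type : choiceType) sprod_face sprod_degen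
          _ _ _ _ _ _).
- by move=> n i j [x y] h; congr pair; apply: face_face.
- by move=> n i j [x y] h; congr pair; apply: face_degen_lt.
- by move=> n j [x y] h; congr pair; apply: face_degen_id.
- by move=> n j [x y] h; congr pair; apply: face_degen_succ.
- by move=> n i j [x y] h; congr pair; apply: face_degen_gt.
- by move=> n i j [x y] h; congr pair; apply: degen_degen.
Defined.

End Product.

Section Associativity.
Variables X Y Z : sset.

Definition sprodA : smap (sprod X (sprod Y Z)) (sprod (sprod X Y) Z).
Proof.
by refine (@SMap (sprod X (sprod Y Z)) (sprod (sprod X Y) Z)
  (fun n u => ((u.1, u.2.1), u.2.2)) _ _).
Defined.

Definition sprodAV : smap (sprod (sprod X Y) Z) (sprod X (sprod Y Z)).
Proof.
by refine (@SMap (sprod (sprod X Y) Z) (sprod X (sprod Y Z))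
  (fun n u => (u.1.1, (u.1.2, u.2))) _ _).
Defined.

End Associativity.

Section Iterated.
Variable X : sset.

Definition castx m n (e : m = n) (x : X m) : X n := ecast k (X k) e x.

Fixpoint faces_from (p k n : nat) : X (k + n)%N -> X n :=
  if k is k'.+1 then fun x => faces_from p (face (p + k') x) else id.

(* d_p d_(p+1) ... d_q x, and x for q = p - 1 *)
Definition faces (p q n : nat) : X (q.+1 - p + n)%N -> X n :=
  @faces_from p (q.+1 - p) n.

(* s_(i_1) ... s_(i_k) x for l = [:: i_1; ...; i_k] *)
Fixpoint degens (l : seq nat) n (x : X n) : X (size l + n)%N :=
  if l is i :: l' then degen i (degens l' x) else x.

Definition degenerate n : X n -> Prop :=
  if n is n'.+1 then
    fun x => exists i (y : X n'), (i <= n')%N /\ x = degen i y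
  else fun _ => False.

End Iterated.

Arguments faces {X} p q {n} x.

(* A + m in decreasing order, so that [degens (shift_set A m)] is           *)
(* s_(A + m) = s_(a_r + m) ... s_(a_1 + m) for A = {a_1 < ... < a_r}        *)
Definition shift_set N (A : {set 'I_N}) (m : nat) : seq nat :=
  rev [seq (val i + m)%N | i <- enum A].

(* A (p,q)-shuffle (alpha, beta) is given by alpha; beta is ~: alpha *)
Definition shuffle (p q : nat) := {A : {set 'I_(p + q)} | #|A| == p}.

Section ShuffleSign.
Variables (N : nat) (A : {set 'I_N}).

Definition shuffle_fun (i : 'I_N) : 'I_N := nth i (enum A ++ enum (~: A)) i.

Lemma shuffle_fun_inj : injective shuffle_fun.
Proof.
have sz : size (enum A ++ enum (~: A)) = N.
  by rewrite size_cat -!cardE cardsC card_ord.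
have un : uniq (enum A ++ enum (~: A)).
  rewrite cat_uniq !enum_uniq andbT /=; apply/hasPn => i.
  by rewrite !mem_enum in_setC.
move=> i j; rewrite /shuffle_fun (set_nth_default i) ?sz // => /eqP.
by rewrite nth_uniq ?sz // => /eqP /val_inj.
Qed.

(* the permutation (a_1 < ... < a_p, b_1 < ... < b_q) *)
Definition shuffle_perm : {perm 'I_N} := perm shuffle_fun_inj.

End ShuffleSign.

(* [{malg R[K]}] with its scalar multiplication extended to rings in which  *)
(* 1 = 0 is allowed                                                         *)
Definition freemod (R : comPzRingType) (K : choiceType) := {malg R[K]}.

Section FreeModule.
Variables (R : comPzRingType) (K : choiceType).

HB.instance Definition _ := GRing.Zmodule.on (freemod R K).

Definition fmscale (a : R) (c : freemod R K) : freemod R K :=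
  [malg k in msupp c => a * c@_k].

Lemma fmscaleE a c k : (fmscale a c)@_k = a * c@_k.
Proof.
rewrite /fmscale mcoeffE; case: ifP => // /negbT /mcoeff_outdom ->.
by rewrite mulr0.
Qed.

Let fmscaleA a b c : fmscale a (fmscale b c) = fmscale (a * b) c.
Proof. by apply/malgP => k; rewrite !fmscaleE mulrA. Qed.
Let fmscale1 : left_id 1 fmscale.
Proof. by move=> c; apply/malgP => k; rewrite !fmscaleE mul1r. Qed.
Let fmscaleDr : right_distributive fmscale +%R.
Proof.
by move=> a c d; apply/malgP => k; rewrite fmscaleE !mcoeffD !fmscaleE mulrDr.
Qed.
Let fmscaleDl c : {morph fmscale^~ c : a b / a + b}.
Proof.
by move=> a b; apply/malgP => k; rewrite fmscaleE mcoeffD !fmscaleE mulrDl.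
Qed.

HB.instance Definition _ := GRing.Zmodule_isLmodule.Build R (freemod R K)
  fmscaleA fmscale1 fmscaleDr fmscaleDl.

Lemma fmcoeffZ a (c : freemod R K) k : (a *: c)@_k = a * c@_k.
Proof. exact: fmscaleE. Qed.

Section Extension.
Variables (V : lmodType R) (f : K -> V).

Definition fmext (c : freemod R K) : V := \sum_(k <- msupp c) c@_k *: f k.

Lemma fmextEw (d : {fset K}) (c : freemod R K) :
  (msupp c `<=` d)%fset -> fmext c = \sum_(k <- d) c@_k *: f k.
Proof.
move=> le; rewrite /fmext (big_fset_incl _ le) // => k _ /mcoeff_outdom ->.
by rewrite scale0r.
Qed.

Lemma fmext_is_linear : linear fmext.
Proof.
move=> a c d; pose D := (msupp c `|` msupp d `|` msupp (a *: c + d))%fset.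
rewrite (@fmextEw D) ?fsubsetUr // (@fmextEw D c); last first.
  by rewrite /D -fsetUA fsubsetUl.
rewrite (@fmextEw D d); last first.
  by rewrite (fsubset_trans (fsubsetUr (msupp c) _)) // fsubsetUl.
rewrite scaler_sumr -big_split /=; apply: eq_bigr => k _.
by rewrite mcoeffD fmcoeffZ scalerDl scalerA.
Qed.

HB.instance Definition _ :=
  GRing.isLinear.Build R (freemod R K) V _ fmext fmext_is_linear.

Lemma fmextU a k : fmext << a *g k >> = a *: f k.
Proof.
rewrite (@fmextEw [fset k]%fset) ?msuppU_le // big_seq_fset1.
by rewrite mcoeffUU.
Qed.

End Extension.
End FreeModule.

Section NormalizedChains.
Variables (R : comPzRingType) (X : sset) (n : nat).

(* The span of the degenerate simplices inside the free module on X_n,      *)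
(* i.e. the chains all of whose simplices are degenerate.                   *)
Definition degenerate_chains : {pred freemod R (X n)} :=
  fun c => all (fun x => `[< degenerate x >]) (msupp c).

Lemma degenerate_chainsP (c : freemod R (X n)) :
  reflect (forall x, c@_x != 0 -> degenerate x) (c \in degenerate_chains).
Proof.
apply: (iffP allP) => h x.
  by rewrite mcoeff_neq0 => /h /asboolP.
by rewrite -mcoeff_neq0 => /h /asboolP.
Qed.

Lemma degenerate_chains_zmod : zmod_closed degenerate_chains.
Proof.
split; first by apply/degenerate_chainsP => x; rewrite mcoeff0 eqxx.
move=> c d /degenerate_chainsP hc /degenerate_chainsP hd.
apply/degenerate_chainsP => x; rewrite mcoeffB.
have [/eqP c0|/hc //] := boolP (c@_x == 0).
have [/eqP d0|/hd //] := boolP (d@_x == 0).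
by rewrite c0 d0 subr0 eqxx.
Qed.

HB.instance Definition _ :=
  GRing.isZmodClosed.Build (freemod R (X n)) degenerate_chains
    degenerate_chains_zmod.

Lemma degenerate_chainsZ a (c : freemod R (X n)) :
  c \in degenerate_chains -> a *: c \in degenerate_chains.
Proof.
move=> /degenerate_chainsP hc; apply/degenerate_chainsP => x.
rewrite fmcoeffZ; have [/eqP ->|/hc //] := boolP (c@_x == 0).
by rewrite mulr0 eqxx.
Qed.

Definition nchains := Quotient.quot degenerate_chains.

HB.instance Definition _ := GRing.Zmodule.on nchains.

Definition nclass (c : freemod R (X n)) : nchains := \pi_nchains c.

Lemma nclass_eq c d : (nclass c = nclass d) <-> (c - d \in degenerate_chains).
Proof. by rewrite Quotient.idealrBE; split => [/eqP|/eqP]. Qed.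

Lemma nclass_repr (u : nchains) : nclass (repr u) = u.
Proof. exact: reprK. Qed.

Lemma nclassD c d : nclass (c + d) = nclass c + nclass d.
Proof. exact: (raddfD (\pi_nchains)). Qed.

Definition nscale (a : R) (u : nchains) : nchains := nclass (a *: repr u).

Lemma nscale_class a c : nscale a (nclass c) = nclass (a *: c).
Proof.
apply/nclass_eq; rewrite -scalerBr; apply: degenerate_chainsZ.
by apply/nclass_eq; rewrite nclass_repr.
Qed.

Let nscaleA a b c : nscale a (nscale b c) = nscale (a * b) c.
Proof. by rewrite -[c]nclass_repr !nscale_class scalerA. Qed.
Let nscale1 : left_id 1 nscale.
Proof. by move=> c; rewrite -[c]nclass_repr nscale_class scale1r. Qed.
Let nscaleDr : right_distributive nscale +%R.
Proof.
move=> a c d; rewrite -[c]nclass_repr -[d]nclass_repr -nclassD !nscale_class.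
by rewrite -nclassD scalerDr.
Qed.
Let nscaleDl c : {morph nscale^~ c : a b / a + b}.
Proof.
by move=> a b; rewrite -[c]nclass_repr !nscale_class -nclassD scalerDl.
Qed.

HB.instance Definition _ := GRing.Zmodule_isLmodule.Build R nchains
  nscaleA nscale1 nscaleDr nscaleDl.

Lemma nclass_is_linear : linear nclass.
Proof. by move=> a c d; rewrite nclassD -nscale_class. Qed.

HB.instance Definition _ :=
  GRing.isLinear.Build R (freemod R (X n)) nchains _ nclass nclass_is_linear.

Definition ngen (x : X n) : nchains := nclass << x >>.

Lemma ngen_degenerate x : degenerate x -> ngen x = 0.
Proof.
move=> hx; apply: (etrans _ (raddf0 nclass)); apply/nclass_eq.
rewrite subr0; apply/degenerate_chainsP => y.
rewrite mcoeffU; case: (x =P y) => [<- //|_].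
by rewrite mulr0n eqxx.
Qed.

Section Lift.
Variables (V : lmodType R) (f : X n -> V).
Hypothesis f_degenerate : forall x, degenerate x -> f x = 0.

(* the linear map on normalized chains given by f on simplices; the         *)
(* hypothesis makes it independent of the representative                    *)
Definition nlift of (forall x, degenerate x -> f x = 0) : nchains -> V :=
  fun u => fmext f (repr u).

Lemma nlift_class c : nlift f_degenerate (nclass c) = fmext f c.
Proof.
apply/eqP; rewrite -subr_eq0 /nlift -linearB /=; apply/eqP.
have /degenerate_chainsP h : repr (nclass c) - c \in degenerate_chains.
  by apply/nclass_eq; rewrite nclass_repr.
rewrite /fmext big_seq big1 // => x; rewrite -mcoeff_neq0 => /h hx.
by rewrite f_degenerate // scaler0.
Qed.

Lemma nlift_gen x : nlift f_degenerate (ngen x) = f x.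
Proof. by rewrite nlift_class fmextU scale1r. Qed.

Lemma nlift_is_linear : linear (nlift f_degenerate).
Proof.
move=> a c d; rewrite -[c]nclass_repr -[d]nclass_repr -linearP.
by rewrite !nlift_class linearP.
Qed.

HB.instance Definition _ := GRing.isLinear.Build R nchains V _
  (nlift f_degenerate) nlift_is_linear.

End Lift.
End NormalizedChains.

Section InducedMap.
Variables (R : comPzRingType) (X Y : sset) (f : smap X Y) (n : nat).

Lemma smap_degenerate (x : X n) : degenerate x -> ngen R (f n x) = 0.
Proof.
case: n x => [//|k] x [i [y [le ->]]]; apply: ngen_degenerate.
by exists i, (f k y); rewrite smap_degen.
Qed.

Definition nchains_map : {linear nchains R X n -> nchains R Y n} :=
  nlift smap_degenerate.

End InducedMap.

Section DegenerateAt.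
Variable X : sset.

Definition degen_at i n (x : X n) : Prop :=
  exists n' (y : X n'), (i <= n')%N /\
    existT (fun k => X k : Type) n x = existT _ n'.+1 (degen i y).

Lemma degen_atP i n (x : X n.+1) :
  degen_at i x <-> exists y : X n, (i <= n)%N /\ x = degen i y.
Proof.
split=> [[n' [y [le e]]]|[y [le ->]]]; last by exists n, y.
have en : n = n' by have [] := congr1 (@projT1 _ _) e.
move: le y e; rewrite -{}en => le y e.
exists y; split => //.
by apply: (inj_pair2_eq_dec _ (@eq_comparable nat)) e.
Qed.

Lemma degen_at_cast i m n (e : m = n) (x : X m) :
  degen_at i x -> degen_at i (castx e x).
Proof. by case: n / e. Qed.

Lemma degen_at_degen i n (x : X n) : (i <= n)%N -> degen_at i (degen i x).
Proof. by move=> le; exists n, x. Qed.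

Lemma degen_at_face_gt i j n (x : X n.+1) :
  (i.+1 < j <= n.+1)%N -> degen_at i x -> degen_at i (face j x).
Proof.
move=> hj /degen_atP [y [le ->]].
case: n x hj y le => [|n] x hj y le; first by lia.
by rewrite face_degen_gt //; apply: degen_at_degen; lia.
Qed.

Lemma degen_at_face_lt i j n (x : X n.+1) :
  (j < i)%N -> degen_at i x -> degen_at i.-1 (face j x).
Proof.
move=> hj /degen_atP [y [le ->]].
case: n x y le => [|n] x y le; first by lia.
by rewrite face_degen_lt ?hj //; apply: degen_at_degen; lia.
Qed.

Lemma degen_at_degen_le i j n (x : X n) :
  (j <= i)%N -> degen_at i x -> degen_at i.+1 (degen j x).
Proof.
case: n x => [|n] x hj; first by move=> [n' [y [_ e]]]; have := congr1 (@projT1 _ _) e.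
move=> /degen_atP [y [le ->]].
by rewrite degen_degen ?hj //; apply: degen_at_degen.
Qed.

Lemma degen_at_degen_gt i j n (x : X n) :
  (i < j <= n)%N -> degen_at i x -> degen_at i (degen j x).
Proof.
case: n x => [|n] x hj; first by lia.
move=> /degen_atP [y [le ->]].
have -> : j = j.-1.+1 by lia.
by rewrite -degen_degen; [apply: degen_at_degen; lia|lia].
Qed.

Lemma degen_at_faces_gt i p k n (x : X (k + n)%N) :
  (i.+1 < p <= n.+1)%N -> degen_at i x -> degen_at i (faces_from p x).
Proof.
move=> hp; elim: k x => //= k IH x hx; apply/IH/degen_at_face_gt => //.
by lia.
Qed.

Lemma degen_at_faces_lt i p k n (x : X (k + n)%N) :
  (p + k <= i)%N -> degen_at i x -> degen_at (i - k) (faces_from p x).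
Proof.
elim: k i x => [|k IH] i x hp hx; first by rewrite subn0.
by rewrite subnS predn_sub; apply: IH; [lia | apply: degen_at_face_lt; [lia|]].
Qed.

(* position in degens l x of a degeneracy s_i of x *)
Definition degens_pos (l : seq nat) (i : nat) : nat :=
  foldr (fun j t => if (j <= t)%N then t.+1 else t) i l.

Lemma degens_pos_bound l i : (i <= degens_pos l i <= i + size l)%N.
Proof. by elim: l => [|j l] /=; [lia | case: ifP; lia]. Qed.

Lemma degens_posE l i :
  (forall j, j \in l -> (i < j)%N) -> degens_pos l i = i.
Proof.
elim: l => //= j l IH h; rewrite IH => [|k kl].
  by rewrite leqNgt h ?mem_head.
by rewrite h // inE kl orbT.
Qed.

Lemma degens_pos_notin l i : sorted gtn l -> degens_pos l i \notin l.
Proof.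
elim: l => //= j l IH; rewrite path_sortedE; last first.
  by move=> ? ? ?; rewrite /gtn /=; lia.
case/andP => /allP /= lt /IH nin; rewrite inE negb_or.
case: ifP => hj; apply/andP; split.
- by lia.
- by apply/negP => /lt; lia.
- by lia.
- by [].
Qed.

Definition degens_valid (l : seq nat) n :=
  sorted gtn l /\ forall j, j \in l -> (j < size l + n)%N.

Lemma degens_valid_cons j l n : degens_valid (j :: l) n ->
  [/\ degens_valid l n, (j <= size l + n)%N &
      forall k, k \in l -> (k < j)%N].
Proof.
rewrite /degens_valid /= path_sortedE; last first.
  by move=> ? ? ?; rewrite /gtn /=; lia.
move=> [/andP [/allP /= lt st] h].
have hj := h _ (mem_head _ _).
by split=> //; split=> // k kl; have := lt _ kl; lia.
Qed.

Lemma degen_at_degens l i n (x : X n) : degens_valid l n ->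
  degen_at i x -> degen_at (degens_pos l i) (degens l x).
Proof.
elim: l => //= j l IH /degens_valid_cons [v hj lt] /(IH v) hx.
case: ifP => h; first exact: degen_at_degen_le.
by apply: degen_at_degen_gt => //; rewrite ltnNge h.
Qed.

Lemma degen_at_degens_mem l j n (x : X n) : degens_valid l n ->
  j \in l -> degen_at j (degens l x).
Proof.
elim: l => //= k l IH /degens_valid_cons [v hk lt]; rewrite inE.
case/orP => [/eqP ->|jl]; first exact: degen_at_degen.
by apply: degen_at_degen_gt; [rewrite lt | exact: IH].
Qed.

End DegenerateAt.

Section ShiftSet.
Variables (N m : nat).
Implicit Type A : {set 'I_N}.

Lemma size_shift_set A : size (shift_set A m) = #|A|.
Proof. by rewrite size_rev size_map -cardE. Qed.

Lemma mem_shift_set A j :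
  (j \in shift_set A m) = [exists i in A, j == (val i + m)%N].
Proof.
rewrite mem_rev; apply/mapP/exists_inP => [[i]|[i iA /eqP ->]].
  by rewrite mem_enum => iA ->; exists i.
by exists i; rewrite ?mem_enum.
Qed.

Lemma shift_setC A j : (m <= j < m + N)%N ->
  (j \in shift_set (~: A) m) = (j \notin shift_set A m).
Proof.
move=> hj; have lt : (j - m < N)%N by lia.
have E (B : {set 'I_N}) : (j \in shift_set B m) = (Ordinal lt \in B).
  rewrite mem_shift_set; apply/exists_inP/idP => [[i iB /eqP e]|h].
    by congr (_ \in B): iB; apply: val_inj; rewrite /= e addnK.
  by exists (Ordinal lt) => //=; apply/eqP; lia.
by rewrite !E in_setC.
Qed.

Lemma shift_set_valid A n : (m + N <= #|A| + n)%N ->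
  degens_valid (shift_set A m) n.
Proof.
move=> le; split; last first.
  move=> j; rewrite size_shift_set mem_shift_set => /exists_inP [i _ /eqP ->].
  by apply: leq_trans le; rewrite [ltnLHS]addnC ltn_add2l; apply: ltn_ord.
rewrite /shift_set rev_sorted sorted_map.
have : sorted ltn [seq val i | i <- enum A].
  rewrite -[enum _](eq_filter (mem_enum _)).
  rewrite -(eq_filter (mem_map val_inj _)) -filter_map.
  by rewrite (sorted_filter ltn_trans) // unlock val_ord_enum iota_ltn_sorted.
rewrite sorted_map; apply: sub_sorted => i j /=.
by rewrite ltn_add2r.
Qed.
End ShiftSet.

Section EMLTerm.
Variables (X Y : sset) (n p q : nat) (lt_pq_n : (p + q < n)%N).
Variable S : shuffle p.+1 q.

Let m := (n - p - q)%N.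
Let alpha : {set 'I_(p.+1 + q)} := val S.
Let beta : {set 'I_(p.+1 + q)} := ~: alpha.

Let card_alpha : #|alpha| = p.+1. Proof. exact: (eqP (valP S)). Qed.

Let card_beta : #|beta| = q.
Proof. by have := cardsC alpha; rewrite card_alpha card_ord => /addnI. Qed.

Lemma eml_dim_faces_left : n = (n.+1 - (n - q + 1) + (n - q))%N.
Proof. lia. Qed.

Lemma eml_dim_faces_right : n = ((n - q - 1).+1 - m + (n - p))%N.
Proof. rewrite /m; lia. Qed.

Lemma eml_dim_degens_left : (size (shift_set beta m) + (n - q).+1 = n.+1)%N.
Proof. rewrite size_shift_set card_beta; lia. Qed.

Lemma eml_dim_degens_right : (size (shift_set alpha m) + (n - p) = n.+1)%N.
Proof. rewrite size_shift_set card_alpha; lia. Qed.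

Definition eml_left (x : X n) : X n.+1 :=
  castx eml_dim_degens_left
    (degens (shift_set beta m)
      (degen (m - 1) (faces (n - q + 1) n (castx eml_dim_faces_left x)))).

Definition eml_right (y : Y n) : Y n.+1 :=
  castx eml_dim_degens_right
    (degens (shift_set alpha m) (faces m (n - q - 1) (castx eml_dim_faces_right y))).

Lemma eml_left_right_degenerate (x : X n) (y : Y n) :
  degenerate (X := sprod X Y) ((x, y) : sprod X Y n) ->
  degenerate (X := sprod X Y) ((eml_left x, eml_right y) : sprod X Y n.+1).
Proof.
move=> dxy.
have [i [i_n dx dy]] : exists i, [/\ (i < n)%N, degen_at i x & degen_at i y].
  case: n x y dxy => [//|k] x y [i [[x' y'] [le [-> ->]]]].
  by exists i; split => //; apply: degen_at_degen.
suff [k [kx ky]] : exists k,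
    degen_at k (eml_left x) /\ degen_at k (eml_right y).
  case/degen_atP: kx => x' [le ->]; case/degen_atP: ky => y' [_ ->].
  by exists k, (x', y').
have v_beta : degens_valid (shift_set beta m) (n - q).+1.
  by apply: shift_set_valid; rewrite card_beta /m; lia.
have v_alpha : degens_valid (shift_set alpha m) (n - p).
  by apply: shift_set_valid; rewrite card_alpha /m; lia.
have ge_beta j : j \in shift_set beta m -> (m <= j)%N.
  by rewrite mem_shift_set => /exists_inP [a _ /eqP ->]; apply: leq_addl.
have ge_alpha j : j \in shift_set alpha m -> (m <= j)%N.
  by rewrite mem_shift_set => /exists_inP [a _ /eqP ->]; apply: leq_addl.
have dx' := degen_at_cast eml_dim_faces_left dx.
have dy' := degen_at_cast eml_dim_faces_right dy.
have [i_nq|nq_i] := ltnP i (n - q).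
  have {}dx' : degen_at i (faces _ _ (castx eml_dim_faces_left x)).
    by apply: degen_at_faces_gt dx'; lia.
  have [i_m|m_i] := ltnP i (m - 1).
    exists i; split; apply: degen_at_cast.
      rewrite -[i](@degens_posE (shift_set beta m)); last first.
        by move=> j /ge_beta; lia.
      by apply: degen_at_degens => //; apply: degen_at_degen_gt => //; lia.
    rewrite -[i](@degens_posE (shift_set alpha m)); last first.
      by move=> j /ge_alpha; lia.
    apply: degen_at_degens => //.
    by apply: degen_at_faces_gt dy'; rewrite /m in i_m *; lia.
  pose k := degens_pos (shift_set beta m) i.+1; exists k.
  have k_bound : (m <= k < m + (p.+1 + q))%N.
    have := degens_pos_bound (shift_set beta m) i.+1.
    by rewrite -/k size_shift_set card_beta /m in m_i *; lia.
  split; apply: degen_at_cast.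
    by apply: degen_at_degens => //; apply: degen_at_degen_le.
  apply: degen_at_degens_mem => //.
  rewrite -[alpha]setCK shift_setC // degens_pos_notin //.
  by case: v_beta.
have {}dy' : degen_at (i - ((n - q - 1).+1 - m))
    (faces _ _ (castx eml_dim_faces_right y)).
  by apply: degen_at_faces_lt dy'; rewrite /m; lia.
set t := (i - _)%N in dy'.
pose k := degens_pos (shift_set alpha m) t; exists k.
have k_bound : (m <= k < m + (p.+1 + q))%N.
  have := degens_pos_bound (shift_set alpha m) t.
  by rewrite -/k size_shift_set card_alpha /t /m; lia.
split; apply: degen_at_cast; last exact: degen_at_degens.
apply: degen_at_degens_mem => //.
rewrite shift_setC // degens_pos_notin //.
by case: v_alpha.
Qed.

End EMLTerm.

Section EML.
Variables (R : comPzRingType) (X Y : sset) (n : nat).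

Lemma eml_index (q : 'I_n) (p : 'I_(n - q)) : (p + q < n)%N.
Proof. by rewrite addnC -ltn_subRL. Qed.

(* H (x, y); the range of (q, p) is that of p, q >= 0 with p + q < n *)
Definition eml_simplex (u : sprod X Y n) : nchains R (sprod X Y) n.+1 :=
  \sum_(q < n) \sum_(p < n - q) \sum_(S : shuffle p.+1 q)
    (-1) ^+ (n - p - q + 1 + shuffle_perm (val S))%N *:
      ngen R (X := sprod X Y)
        (eml_left (eml_index p) S u.1, eml_right (eml_index p) S u.2).

Lemma eml_simplex_degenerate u : degenerate u -> eml_simplex u = 0.
Proof.
case: u => x y du; rewrite /eml_simplex.
apply: big1 => q _; apply: big1 => p _; apply: big1 => S _.
rewrite ngen_degenerate ?scaler0 //.
exact: eml_left_right_degenerate.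
Qed.

Definition eml_homotopy :
    {linear nchains R (sprod X Y) n -> nchains R (sprod X Y) n.+1} :=
  nlift eml_simplex_degenerate.

End EML.

Section TripleProduct.
Variables (R : comPzRingType) (X Y Z : sset) (n : nat).

(* X x Y x Z is bracketed as (X x Y) x Z; [eml_X_YZ] is transported along   *)
(* the associativity isomorphism.                                          *)
Definition sprod3 := sprod (sprod X Y) Z.

Definition eml_XY_Z : {linear nchains R sprod3 n -> nchains R sprod3 n.+1} :=
  eml_homotopy R (sprod X Y) Z n.

Definition eml_X_YZ : {linear nchains R sprod3 n -> nchains R sprod3 n.+1} :=
  nchains_map R (sprodA X Y Z) n.+1 \o eml_homotopy R X (sprod Y Z) n
    \o nchains_map R (sprodAV X Y Z) n.

End TripleProduct.

(* Main.v *)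
Require Import Defs.
From mathcomp Require Import all_boot all_fingroup all_algebra zify.
From mathcomp Require Import finmap.
From mathcomp.classical Require Import boolp.
From mathcomp.multinomials Require Import monalg.
From Stdlib Require Import Eqdep_dec.

Set Implicit Arguments.
Unset Strict Implicit.
Unset Printing Implicit Defensive.

Import GRing.Theory.
Local Open Scope ring_scope.

(** The homotopy is a signed sum of pairs (x f, y g), where f and g are
    monotone maps from [n+1] to [n], and such a pair traces a staircase in the
    grid [n] x [n]: it climbs the diagonal from (0,0) to (a,a), jumps
    vertically to some (a,r), and then follows unit steps from (a,r) to (r,n).
    The n - a unit steps form a word P in two letters, and r is a plus the
    number of horizontal letters of P, so the terms are indexed by the pairs
    (a, P) with a + |P| = n. Words P without horizontal letters may be
    included: for these r = a, the jump repeats the vertex (a,a), and the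
    simplex is degenerate. The sign becomes (-1)^(a + inversions of P). This is
    [eml_homotopyE].

    A term of either composite is therefore indexed by two staircases
    (a1, P1) and (b1, Q1), and it traces a path in [n]^3, with one axis for each
    of X, Y, Z. In H_(XxY,Z) H_(X,YxZ) the three coordinate maps are l1 l2,
    r1 l2 and r1 r2, and in H_(X,YxZ) H_(XxY,Z) they are l1 l2, l1 r2 and
    r1 r2, where l and r are the two coordinates of a staircase. A path that
    repeats a vertex gives a degenerate simplex, and the remaining paths are of
    two kinds. They leave the diagonal at (a,a,a), make a jump, follow a word U
    in two letters, make a second jump, and end with a word T in the letters
    x, y, z of single-coordinate steps, where a + |U| + |T| = n. Either z jumps
    first, U consists of simultaneous xy-steps and of z-steps, and y jumps next;
    or y and z jump together, U consists of x-steps and of simultaneous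
    yz-steps, and z jumps next.

    Each composite produces each of these paths exactly once: [blockA] and
    [blockB] give the two staircases from which they arise in the two
    composites, [block_paths] says that the paths agree, and
    [blockA_or_repeats] and [blockB_or_repeats] say that every other index is
    degenerate. By [block_degrees] the two signs are opposite, so the two
    composites cancel term by term.

    Simplices are compared through their vertices. The relation [vert x f y]
    says that y is the image of x under the operator of the monotone map f. It
    is functional in y and is compatible with faces and degeneracies, so that
    an iterated simplicial operator is determined by what it does to vertices,
    and a map f that takes a value twice yields a degenerate simplex. *)

(** * Simplicial operators as monotone maps *)

Section Vertices.
Local Open Scope nat_scope.
Variable X : sset.

(** Simplices of all dimensions are put into one type, so that the equations
    between iterated operators need no transport along equalities of
    dimensions. *)
Definition total := {n : nat & X n : Type}.
Definition pack n (x : X n) : total := existT (fun k => X k : Type) n x.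
Definition dim (t : total) : nat := projT1 t.

Definition tface i (t : total) : total :=
  let: existT n x := t in
  (if n is n'.+1 return X n -> total then fun y => pack (face i y)
   else fun y => pack y) x.

Definition tdegen i (t : total) : total := pack (degen i (projT2 t)).

Arguments dim : simpl never.
Arguments tface : simpl never.
Arguments tdegen : simpl never.

Lemma pack_inj n : injective (@pack n).
Proof. by move=> x y e; apply: (inj_pair2_eq_dec _ (@eq_comparable nat)) e. Qed.

Lemma dim_tface i t : dim (tface i t) = (dim t).-1.
Proof. by case: t => [[|n] x]. Qed.

Lemma dim_tdegen i t : dim (tdegen i t) = (dim t).+1.
Proof. by []. Qed.

Lemma dim_iter_tdegen i k t : dim (iter k (tdegen i) t) = k + dim t.
Proof. by elim: k => //= k IH; rewrite dim_tdegen IH. Qed.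

Lemma tface_tface i j t : i < j <= dim t -> 1 < dim t ->
  tface i (tface j t) = tface j.-1 (tface i t).
Proof. by case: t => [[|[|n]] x] // h _; congr pack; apply: face_face. Qed.

Lemma tface_tdegen_lt i j t : i < j <= dim t ->
  tface i (tdegen j t) = tdegen j.-1 (tface i t).
Proof.
case: t => [[|n] x] h; first by rewrite /dim /= in h; lia.
by congr pack; apply: face_degen_lt.
Qed.

Lemma tface_tdegen_id j t : j <= dim t -> tface j (tdegen j t) = t.
Proof. by case: t => n x h; congr pack; apply: face_degen_id. Qed.

Lemma tface_tdegen_succ j t : j <= dim t -> tface j.+1 (tdegen j t) = t.
Proof. by case: t => n x h; congr pack; apply: face_degen_succ. Qed.

Lemma tface_tdegen_gt i j t : j.+1 < i <= (dim t).+1 ->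
  tface i (tdegen j t) = tdegen j (tface i.-1 t).
Proof.
case: t => [[|n] x] h; first by rewrite /dim /= in h; lia.
by congr pack; apply: face_degen_gt.
Qed.

Lemma tdegen_tdegen i j t : i <= j <= dim t ->
  tdegen i (tdegen j t) = tdegen j.+1 (tdegen i t).
Proof. by case: t => n x h; congr pack; apply: degen_degen. Qed.

(** The operator of a monotone map that takes the value i exactly c times and
    every other value once. *)
Definition repeat_vertex i c (t : total) : total :=
  if c is k.+1 then iter k (tdegen i) t else tface i t.

(** A monotone map is encoded by the list c of its multiplicities, c being
    indexed from i. The top vertices are treated first, so that the operators
    at lower indices are not shifted. *)
Fixpoint repeat_vertices i (c : seq nat) (t : total) : total :=
  if c is c0 :: c' then repeat_vertex i c0 (repeat_vertices i.+1 c' t) else t.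

(** The list of values of the monotone map with multiplicities c. *)
Fixpoint unary i (c : seq nat) : seq nat :=
  if c is c0 :: c' then nseq c0 i ++ unary i.+1 c' else [::].

Lemma size_unary i c : size (unary i c) = sumn c.
Proof. by elim: c i => //= c0 c IH i; rewrite size_cat size_nseq IH. Qed.

Lemma unary_ge i c j : j \in unary i c -> i <= j.
Proof.
elim: c i => //= c0 c IH i; rewrite mem_cat => /orP [|/IH]; last by lia.
by rewrite mem_nseq => /andP [_ /eqP ->].
Qed.

Lemma unary_inj i c d : size c = size d -> unary i c = unary i d -> c = d.
Proof.
elim: c i d => [|c0 c IH] i [|d0 d] //= [sz] e.
have cnt k e' : count_mem i (nseq k i ++ unary i.+1 e') = k.
  rewrite count_cat count_nseq /= eqxx mul1n.
  rewrite (_ : count _ (unary _ _) = 0) ?addn0 //.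
  apply/eqP; rewrite -leqn0 leqNgt -has_count; apply/hasPn => j /unary_ge /=.
  by lia.
have e0 : c0 = d0 by rewrite -(cnt c0 c) e cnt.
congr (_ :: _) => //; apply: (IH i.+1) sz _; move: e; rewrite e0.
by move/eqP; rewrite eqseq_cat // eqxx /= => /eqP.
Qed.

Lemma dim_repeat_vertices i c t : (dim t).+1 = i + size c -> 0 < i + sumn c ->
  (dim (repeat_vertices i c t)).+1 = i + sumn c.
Proof.
elim: c i => [|c0 c IH] i /= e; first by lia.
have {}IH : (dim (repeat_vertices i.+1 c t)).+1 = i.+1 + sumn c.
  by apply: IH; lia.
by case: c0 => [|k] /= pos; rewrite ?dim_tface ?dim_iter_tdegen; lia.
Qed.

Lemma tface_repeat_in i j k t : i <= dim t -> j <= k.+1 ->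
  tface (i + j) (iter k.+1 (tdegen i) t) = iter k (tdegen i) t.
Proof.
move=> hi; elim: k j => [|k IH] j hj.
  case: j hj => [|[|j]] // _; first by rewrite addn0 tface_tdegen_id.
  by rewrite addn1 tface_tdegen_succ.
rewrite iterS; case: j hj => [|[|j]] hj.
- by rewrite addn0 tface_tdegen_id // dim_iter_tdegen; lia.
- by rewrite addn1 tface_tdegen_succ // dim_iter_tdegen; lia.
- rewrite tface_tdegen_gt ?dim_iter_tdegen; last by lia.
  by rewrite -[(_ + _).-1]/(i + j.+2).-1 addnS /= IH.
Qed.

Lemma tface_repeat_gt i j k t : i < j <= dim t ->
  tface (k + j) (iter k (tdegen i) t) = iter k (tdegen i) (tface j t).
Proof.
move=> hj; elim: k => [//|k IH]; rewrite !iterS.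
by rewrite tface_tdegen_gt ?dim_iter_tdegen ?addSn /= ?IH //; lia.
Qed.

Lemma tdegen_repeat_in i j k t : i <= dim t -> j <= k ->
  tdegen (i + j) (iter k (tdegen i) t) = iter k.+1 (tdegen i) t.
Proof.
move=> hi; elim: k j => [|k IH] [|j] hj; rewrite ?addn0 //.
by rewrite addnS iterS -tdegen_tdegen ?dim_iter_tdegen ?IH //; lia.
Qed.

Lemma tdegen_repeat_gt i j k t : i < j <= dim t ->
  tdegen (k + j) (iter k (tdegen i) t) = iter k (tdegen i) (tdegen j t).
Proof.
move=> hj; elim: k => [//|k IH]; rewrite !iterS -IH.
by rewrite addSn -tdegen_tdegen ?dim_iter_tdegen //; lia.
Qed.

Lemma delete_nseq (i : nat) j c s : j < c ->
  take j (nseq c i ++ s) ++ drop j.+1 (nseq c i ++ s) = nseq c.-1 i ++ s.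
Proof.
move=> jc; have -> : c = j + (c - j.+1).+1 by lia.
rewrite nseqD -catA take_size_cat ?size_nseq //.
by rewrite drop_cat size_nseq ltnNge leqnSn subSnn /= drop0 catA -nseqD addnS.
Qed.

Lemma duplicate_nseq (i : nat) j c s : j < c ->
  take j.+1 (nseq c i ++ s) ++ drop j (nseq c i ++ s) = nseq c.+1 i ++ s.
Proof.
move=> jc; have -> : c = j + (c - j.+1).+1 by lia.
rewrite nseqD -catA drop_size_cat ?size_nseq //.
rewrite take_cat size_nseq ltnNge leqnSn subSnn /= take0 -catA /=.
by rewrite -[RHS]/(nseq (j + (c - j.+1).+1).+1 i ++ s) -addnS nseqD -catA.
Qed.

(** The normal form absorbs a face: as d_j deletes the j-th vertex, it lowers
    one multiplicity. The simplicial identities move the face past the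
    operators at lower indices until it meets the one it cancels with. *)
Lemma tface_repeat_vertices i c t j :
    (dim t).+1 = i + size c -> 1 < i + sumn c -> j < sumn c ->
  exists d, [/\ size d = size c,
    unary i d = take j (unary i c) ++ drop j.+1 (unary i c) &
    tface (i + j) (repeat_vertices i c t) = repeat_vertices i d t].
Proof.
elim: c i j => [//|c0 c IH] i j /= dt i_gt j_lt.
have dt' : (dim t).+1 = i.+1 + size c by lia.
have dy := dim_repeat_vertices dt' isT.
set y := repeat_vertices i.+1 c t in dy *.
have [j_c0|c0_j] := ltnP j c0.
  exists (c0.-1 :: c); split=> //=; first by rewrite delete_nseq.
  case: c0 j_c0 {dt i_gt j_lt} => [//|[|k]] j_c0 /=.
    by case: j j_c0 => // _; rewrite addn0.
  by rewrite -iterS tface_repeat_in //; lia.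
have [|||d [sz ed ey]] := IH i.+1 (j - c0) => //; try lia.
exists (c0 :: d); split=> /=; first by rewrite sz.
  rewrite ed take_cat drop_cat !size_nseq !ltnNge c0_j (leqW c0_j) /= catA.
  by rewrite subSn.
rewrite -ey -/y.
case: c0 c0_j dt i_gt j_lt {IH ed ey} => [|k] /= c0_j dt i_gt j_lt.
  by rewrite subn0 [RHS]tface_tface ?addSn //=; lia.
by rewrite -tface_repeat_gt; [congr (tface _ _); lia | lia].
Qed.

(** Likewise, a degeneracy duplicates a vertex and raises a multiplicity. *)
Lemma tdegen_repeat_vertices i c t j :
    (dim t).+1 = i + size c -> j < sumn c ->
  exists d, [/\ size d = size c,
    unary i d = take j.+1 (unary i c) ++ drop j (unary i c) &
    tdegen (i + j) (repeat_vertices i c t) = repeat_vertices i d t].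
Proof.
elim: c i j => [//|c0 c IH] i j /= dt j_lt.
have dt' : (dim t).+1 = i.+1 + size c by lia.
have dy := dim_repeat_vertices dt' isT.
set y := repeat_vertices i.+1 c t in dy *.
have [j_c0|c0_j] := ltnP j c0.
  exists (c0.+1 :: c); split=> //=; first by rewrite duplicate_nseq.
  case: c0 j_c0 {dt j_lt} => [//|k] j_c0 /=.
  by rewrite tdegen_repeat_in //; lia.
have [||d [sz ed ey]] := IH i.+1 (j - c0) => //; try lia.
exists (c0 :: d); split=> /=; first by rewrite sz.
  rewrite ed take_cat drop_cat !size_nseq !ltnNge c0_j (leqW c0_j) /= catA.
  by rewrite subSn.
rewrite -ey -/y; case: c0 c0_j dt j_lt {IH ed ey} => [|k] /= c0_j dt j_lt.
  by rewrite subn0 [RHS]tface_tdegen_lt ?addSn //=; lia.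
by rewrite -tdegen_repeat_gt; [congr (tdegen _ _); lia | lia].
Qed.

(** [w] lists the vertices of [t'] as vertices of [t]. *)
Definition spans (t : total) (w : seq nat) (t' : total) : Prop :=
  exists c, [/\ size c = (dim t).+1, unary 0 c = w, 0 < size w &
                t' = repeat_vertices 0 c t].

(** The list of vertices determines the multiplicities, hence the simplex.
    This is how two simplices obtained by different operators are identified. *)
Lemma spans_functional t w y z : spans t w y -> spans t w z -> y = z.
Proof.
move=> [c [sc ec _ ->]] [d [sd ed _ ->]]; congr repeat_vertices.
by apply: (@unary_inj 0); rewrite ?sc ?sd ?ec ?ed.
Qed.

Lemma spans_dim t w y : spans t w y -> (dim y).+1 = size w.
Proof.
move=> [c [sc <- pos ->]]; rewrite dim_repeat_vertices ?sc //.
  by rewrite size_unary.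
by rewrite size_unary in pos.
Qed.

Lemma spans_tface j t w y : 1 < size w -> j < size w -> spans t w y ->
  spans t (take j w ++ drop j.+1 w) (tface j y).
Proof.
move=> w1 jw [c [sc ec pos ey]].
have [|||d [sd ed]] := @tface_repeat_vertices 0 c t j; rewrite ?sc //.
- by rewrite -(size_unary 0) ec.
- by rewrite -(size_unary 0) ec.
rewrite add0n -ey => e; exists d; split; rewrite ?sd ?ed ?ec //.
by rewrite size_cat size_takel ?size_drop; lia.
Qed.

Lemma spans_tdegen j t w y : j < size w -> spans t w y ->
  spans t (take j.+1 w ++ drop j w) (tdegen j y).
Proof.
move=> jw [c [sc ec pos ey]].
have [||d [sd ed]] := @tdegen_repeat_vertices 0 c t j; rewrite ?sc //.
  by rewrite -(size_unary 0) ec.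
rewrite add0n -ey => e; exists d; split; rewrite ?sd ?ed ?ec //.
by rewrite size_cat size_takel ?size_drop; lia.
Qed.

Lemma repeat_vertices_ones i k t : repeat_vertices i (nseq k 1) t = t.
Proof. by elim: k i => //= k IH i; rewrite IH. Qed.

Lemma unary_ones i k : unary i (nseq k 1) = iota i k.
Proof. by elim: k i => //= k IH i; rewrite IH. Qed.

Lemma spans_id t : spans t (iota 0 (dim t).+1) t.
Proof.
exists (nseq (dim t).+1 1); split; rewrite ?size_nseq ?size_iota //.
  exact: unary_ones.
by rewrite repeat_vertices_ones.
Qed.

Lemma unary_zeros i N : unary i (nseq N 0) = [::].
Proof. by elim: N i => //= N IH i. Qed.

Lemma unary_exists i N w : sorted leq w -> all (fun j => i <= j < i + N) w ->
  exists2 c, size c = N & unary i c = w.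
Proof.
elim: N i w => [|N IHN] i w.
  by case: w => [|j w] _ /=; [exists [::] | lia].
elim: w => [|h w IHw] st.
  by exists (nseq N.+1 0); rewrite ?size_nseq ?unary_zeros.
move=> rg; have [eh|ne] := eqVneq h i.
  case/andP: rg => _ /IHw [|[//|c0 c] sz <-]; first exact: path_sorted st.
  by exists (c0.+1 :: c); rewrite ?eh.
have [|c sz e] := IHN i.+1 (h :: w) st; last by exists (0 :: c); rewrite /= ?sz.
move: st; rewrite /= (path_sortedE leq_trans) => /andP [/allP ge _].
move: rg => /= /andP [hi /allP rg]; apply/andP; split; first by lia.
by apply/allP => j jw; have := rg _ jw; have := ge _ jw; lia.
Qed.

Lemma spans_exists t w : sorted leq w -> all (fun j => j <= dim t) w ->
  0 < size w -> exists y, spans t w y.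
Proof.
move=> st rg pos; have [//|c sz e] := @unary_exists 0 (dim t).+1 w st.
by exists (repeat_vertices 0 c t), c.
Qed.

Lemma spans_delete t u v M y : 0 < size u + size M ->
  spans t (u ++ v :: M) y -> spans t (u ++ M) (tface (size u) y).
Proof.
move=> pos /(@spans_tface (size u)); rewrite size_cat /=.
rewrite take_size_cat // drop_cat (ltnNge _ (size u)) leqnSn subSnn /= drop0.
by apply; lia.
Qed.

Lemma spans_duplicate t u v M y : spans t (u ++ v :: M) y ->
  spans t (u ++ v :: v :: M) (tdegen (size u) y).
Proof.
move/(@spans_tdegen (size u)); rewrite size_cat /=.
rewrite drop_size_cat // take_cat (ltnNge _ (size u)) leqnSn subSnn /= take0.
by rewrite -catA; apply; lia.
Qed.

Lemma spans_repeat_vertex t u v M c y : spans t (u ++ v :: M) y ->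
  0 < size u + c + size M ->
  spans t (u ++ nseq c v ++ M) (repeat_vertex (size u) c y).
Proof.
move=> sy; case: c => [|c] pos; first by apply: spans_delete sy; lia.
by elim: c {pos} => [//|c IH]; apply: spans_duplicate IH.
Qed.

(** The composition law [spans_trans] for an initial stretch of operators: the
    vertices below i are still those of y, the others have been replaced. *)
Lemma spans_repeat_vertices t w y i c : spans t w y -> i + size c = size w ->
  0 < i + sumn c ->
  spans t (take i w ++ [seq nth 0 w j | j <- unary i c])
    (repeat_vertices i c y).
Proof.
move=> sy; elim: c i => [|c0 c IH] i /= e pos.
  by rewrite cats0 take_oversize //; lia.
have iw : i < size w by lia.
have {}IH : spans t _ _ := IH i.+1 _ isT.
have {}IH := IH ltac:(lia); rewrite (take_nth 0 iw) cat_rcons in IH.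
have := spans_repeat_vertex (c := c0) IH.
rewrite size_takel ?size_map ?size_unary; last by lia.
rewrite map_cat map_nseq; apply; lia.
Qed.

Lemma spans_trans t w y v z : spans t w y -> spans y v z ->
  spans t [seq nth 0 w j | j <- v] z.
Proof.
move=> sy [c [sc <- pos ->]].
have := spans_repeat_vertices (i := 0) (c := c) sy.
rewrite take0; apply; first by rewrite sc -(spans_dim sy).
by rewrite -(size_unary 0).
Qed.

(** Deleting one of two equal adjacent vertices and duplicating the other one
    leaves the list of vertices unchanged. *)
Lemma spans_repeated t w y j : spans t w y -> j.+1 < size w ->
  nth 0 w j = nth 0 w j.+1 -> y = tdegen j (tface j y).
Proof.
move=> sy jw e; apply: (spans_functional sy).
have ew : w = take j w ++ nth 0 w j :: nth 0 w j :: drop j.+2 w.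
  by rewrite {2}e -!drop_nth ?cat_take_drop //; lia.
set u := take j w in ew; set a := nth 0 w j in ew.
have su : size u = j by rewrite size_takel //; lia.
rewrite ew -su in sy *; set M := drop _ _ in sy *.
by apply/spans_duplicate/(spans_delete _ sy); rewrite /=; lia.
Qed.

End Vertices.

Section MappedVertices.
Local Open Scope nat_scope.
Variables (X Y : sset) (phi : forall n, X n -> Y n).

Let total_map (t : total X) : total Y := pack (phi (projT2 t)).

Lemma spans_map t w y :
    (forall n i (x : X n.+1), phi (face i x) = face i (phi x)) ->
    (forall n i (x : X n), phi (degen i x) = degen i (phi x)) ->
  spans t w y -> spans (total_map t) w (total_map y).
Proof.
move=> phi_face phi_degen.
have map_face i u : total_map (tface i u) = tface i (total_map u).
  by case: u => [[|n] x] //; congr pack; apply: phi_face.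
have map_degen i u : total_map (tdegen i u) = tdegen i (total_map u).
  by case: u => n x; congr pack; apply: phi_degen.
have map_repeat i c u :
    total_map (repeat_vertices i c u) = repeat_vertices i c (total_map u).
  elim: c i => //= -[|k] c IH i /=; rewrite -IH //.
  by elim: k => //= k IHk; rewrite map_degen IHk.
by move=> [c [sc ec pos ->]]; exists c; split.
Qed.

End MappedVertices.

Section VertexFunction.
Local Open Scope nat_scope.
Variables (X : sset) (n : nat) (x : X n).
Implicit Types (f g : nat -> nat).

(** The same relation for a vertex map given as a function on natural numbers,
    whose values above k do not matter. *)
Definition vert f k (y : X k) : Prop :=
  spans (pack x) (mkseq f k.+1) (pack y).

Lemma vert_eq f g k (y : X k) : (forall t, t <= k -> f t = g t) ->
  vert f y -> vert g y.
Proof.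
move=> fg; rewrite /vert (_ : mkseq f _ = mkseq g k.+1) //.
by apply/eq_in_map => t; rewrite mem_iota => ?; apply: fg; lia.
Qed.

Lemma vert_inj f k (y z : X k) : vert f y -> vert f z -> y = z.
Proof. by move=> vy vz; apply: pack_inj; apply: spans_functional vz. Qed.

Lemma vert_id : vert id x.
Proof. by rewrite /vert /mkseq map_id; apply: spans_id. Qed.

Lemma vert_castx f k l (e : k = l) (y : X k) :
  vert f y -> vert f (castx e y).
Proof. by case: l / e. Qed.

Lemma vert_face f k (y : X k.+1) j : j <= k.+1 -> vert f y ->
  vert (f \o bump j) (face j y).
Proof.
move=> jk vy; have := @spans_tface _ j _ _ _ _ _ vy.
rewrite size_mkseq => /(_ isT jk); rewrite /vert; congr spans.
apply: (@eq_from_nth _ 0).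
  by rewrite size_cat size_takel ?size_drop ?size_mkseq; lia.
move=> t; rewrite size_cat size_takel ?size_drop ?size_mkseq; last by lia.
move=> ht; rewrite nth_cat size_takel ?size_mkseq; last by lia.
rewrite nth_mkseq; last by lia.
rewrite -[RHS]/(f (bump j t)) /bump.
case: ltnP => tj; first by rewrite nth_take // nth_mkseq; [congr f|]; lia.
by rewrite nth_drop nth_mkseq; [congr f|]; lia.
Qed.

Lemma vert_degen f k (y : X k) j : j <= k -> vert f y ->
  vert (f \o unbump j) (degen j y).
Proof.
move=> jk vy; have := @spans_tdegen _ j _ _ _ _ vy.
rewrite size_mkseq => /(_ jk); rewrite /vert; congr spans.
apply: (@eq_from_nth _ 0).
  by rewrite size_cat size_takel ?size_drop ?size_mkseq; lia.
move=> t; rewrite size_cat size_takel ?size_drop ?size_mkseq; last by lia.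
move=> ht; rewrite nth_cat size_takel ?size_mkseq; last by lia.
rewrite nth_mkseq; last by lia.
rewrite -[RHS]/(f (unbump j t)) /unbump.
case: ltnP => tj; first by rewrite nth_take // nth_mkseq; [congr f|]; lia.
by rewrite nth_drop nth_mkseq; [congr f|]; lia.
Qed.

Lemma vert_trans f k (y : X k) g l (z : X l) :
    (forall t, t <= l -> g t <= k) -> vert f y ->
    spans (pack y) (mkseq g l.+1) (pack z) -> vert (f \o g) z.
Proof.
move=> gk vy vz; have := spans_trans vy vz; rewrite /vert; congr spans.
rewrite -map_comp; apply/eq_in_map => t; rewrite mem_iota => ht.
by rewrite /= nth_mkseq //; apply: gk; lia.
Qed.

Lemma vert_exists f k : (forall t, t < k -> f t <= f t.+1) -> f k <= n ->
  exists y : X k, vert f y.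
Proof.
move=> mono fk.
have mono_le t s : s <= k -> t <= s -> f t <= f s.
  move=> sk; elim: s sk => [|s IH] sk ts; first by case: t ts.
  move: ts; rewrite leq_eqVlt => /orP [/eqP -> //|ts].
  by apply: leq_trans (mono s sk); apply: IH; lia.
have [||//|[l y] sy] := @spans_exists _ (pack x) (mkseq f k.+1).
- apply/(sortedP 0) => t; rewrite size_mkseq => tk.
  by rewrite !nth_mkseq //; [apply: mono|]; lia.
- apply/allP => _ /mapP [t + ->]; rewrite mem_iota => ?.
  by apply: leq_trans fk; apply: mono_le; lia.
have el : l = k by have := spans_dim sy; rewrite size_mkseq => -[].
by move: y sy; rewrite {}el => y sy; exists y.
Qed.

Lemma vert_repeated f k (y : X k.+1) t : t <= k -> f t = f t.+1 ->
  vert f y -> y = degen t (face t y).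
Proof.
move=> tk e vy; apply: pack_inj; apply: (@spans_repeated _ _ _ (pack y) t vy).
  by rewrite size_mkseq.
by rewrite !nth_mkseq //; lia.
Qed.

End VertexFunction.

(** * The terms of the homotopy as staircases *)

Section Paths.
Local Open Scope nat_scope.
Implicit Types (P : bitseq).

(** The coordinates of the staircase of (a, P) at position t. The diagonal
    occupies the positions up to a, the jump leads from a to a + 1, and the
    letters of P are the steps after that; [true] is a horizontal step. *)
Definition lpath a P t := minn t a + count id (take (t - a.+1) P).

Definition rpath a P t :=
  if t <= a then t else a + count id P + count negb (take (t - a.+1) P).

(** The number of pairs in which a vertical step precedes a horizontal one,
    which is the number of inversions of the shuffle given by P. *)
Fixpoint inversions P :=
  if P is b :: P' then (if b then 0 else count id P') + inversions P' else 0.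

Lemma count_id_negb P : count id P + count negb P = size P.
Proof. exact: (count_predC id). Qed.

End Paths.

Section CharacteristicWord.
Local Open Scope nat_scope.

Lemma enum_filter (T : finType) (A : {set T}) :
  enum A = [seq x <- enum T | x \in A].
Proof. by rewrite enumT; apply: eq_filter. Qed.

(** A shuffle is a set A of positions; its word has the letter [true] at the
    elements of A. *)
Definition set_word N (A : {set 'I_N}) : bitseq :=
  [seq i \in A | i <- enum 'I_N].

Lemma size_set_word N (A : {set 'I_N}) : size (set_word A) = N.
Proof. by rewrite size_map size_enum_ord. Qed.

Lemma count_set_word N (A : {set 'I_N}) : count id (set_word A) = #|A|.
Proof. by rewrite count_map cardE enum_filter size_filter. Qed.

Lemma set_wordC N (A : {set 'I_N}) : set_word (~: A) = map negb (set_word A).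
Proof. by rewrite -map_comp; apply: eq_map => i /=; rewrite in_setC. Qed.

Lemma count_take_ord N (s : seq 'I_N) (p : pred 'I_N) b k :
  map (@nat_of_ord N) s = iota b (size s) ->
  count p (take k s) = count (fun i : 'I_N => p i && (i < b + k)) s.
Proof.
elim: s b k => [|i s IH] b [|k] //= [eb es].
  rewrite addn0 eb ltnn andbF add0n; apply/esym/eqP.
  rewrite -leqn0 leqNgt -has_count.
  apply/hasPn => j js /=.
  have : nat_of_ord j \in map (@nat_of_ord N) s by apply: map_f.
  by rewrite es mem_iota => ?; apply/nandP; right; lia.
by rewrite (IH b.+1) // addSnnS eb; congr (_ + _); case: (p i) => //=; lia.
Qed.

(** A degeneracy operator s_(A + m) lowers t by the number of indices below t,
    and this number is read off from a prefix of the word of A. *)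
Lemma count_shift_set N (A : {set 'I_N}) m t :
  count (fun j => j < t) (shift_set A m) = count id (take (t - m) (set_word A)).
Proof.
rewrite count_rev count_map -map_take count_map.
rewrite (@count_take_ord _ _ _ 0); last by rewrite val_enum_ord size_enum_ord.
rewrite [enum A]enum_filter count_filter; apply: eq_count => i /=.
by rewrite andbC; congr (_ && _); lia.
Qed.

(** The value 0 is taken at position 0 or at position #|A|, according to
    whether 0 lies in A, and what remains is the shuffle of the positive
    elements. *)
Lemma shuffle_perm_lift N (A : {set 'I_N.+1})
    (A' := [set i | lift ord0 i \in A])
    (k : 'I_N.+1) : k = (if ord0 \in A then 0 else #|A'|) :> nat ->
  shuffle_perm A = lift_perm k ord0 (shuffle_perm A').
Proof.
move=> ek.
have enumE (B : {set 'I_N.+1}) : enum B =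
    nseq (ord0 \in B) ord0 ++
      map (lift ord0) (enum [set i | lift ord0 i \in B]).
  rewrite [enum B]enum_filter enum_ordSl /=.
  have -> : [seq x <- [seq lift ord0 i | i <- enum 'I_N] | x \in B] =
      map (lift ord0) (enum [set i | lift ord0 i \in B]).
    rewrite filter_map enum_filter; congr map.
    by apply: eq_filter => i; rewrite /= inE.
  by case: (ord0 \in B).
have compl : [set i | lift ord0 i \in ~: A] = ~: A'.
  by apply/setP => i; rewrite !inE.
apply/permP => i; rewrite permE /shuffle_fun !enumE compl -/A' in_setC.
have sz : size (enum A' ++ enum (~: A')) = N.
  by rewrite size_cat -!cardE cardsC card_ord.
case: (unliftP k i) => [j ->|->].
  rewrite lift_perm_lift permE /shuffle_fun.
  rewrite -(nth_map j (lift k j) (lift ord0)) ?sz // map_cat.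
  move: ek; case: (ord0 \in A) => /= ek.
    by rewrite /bump ek /=.
  rewrite !nth_cat size_map -cardE /= /bump ek.
  have [le|lt] := leqP #|A'| j; last by rewrite lt.
  by rewrite ltnNge leqW //= subSn.
rewrite lift_perm_id; move: ek; case: (ord0 \in A) => /= ek.
  by rewrite ek.
by rewrite nth_cat size_map -cardE ek ltnn subnn.
Qed.

(** Removing the value 0 changes the parity by the position k at which it is
    taken, and [inversions] obeys the same recursion: if 0 is not in A, it
    precedes the #|A'| elements of A. *)
Lemma odd_shuffle_perm N (A : {set 'I_N}) :
  odd_perm (shuffle_perm A) = odd (inversions (set_word A)).
Proof.
elim: N A => [|N IH] A.
  have -> : shuffle_perm A = 1%g by apply/permP => -[].
  by rewrite odd_perm1 /set_word (size0nil (size_enum_ord 0)).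
pose A' := [set i | lift ord0 i \in A].
have wE : set_word A = (ord0 \in A) :: set_word A'.
  rewrite /set_word enum_ordSl /= -map_comp; congr cons.
  by apply: eq_map => i; rewrite /= inE.
have lt : (if ord0 \in A then 0 else #|A'|) < N.+1.
  by case: ifP => // _; rewrite ltnS -[leqRHS](card_ord N) max_card.
rewrite (@shuffle_perm_lift _ _ (Ordinal lt)) // odd_lift_perm IH /= wE /=.
rewrite count_set_word oddD addbF.
by case: ifP.
Qed.

End CharacteristicWord.

Section TermVertices.
Local Open Scope nat_scope.

Lemma vert_faces_from (X : sset) N (x : X N) f p k n (y : X (k + n)) :
  p <= n.+1 -> vert x f y ->
  vert x (f \o (fun t => if t < p then t else t + k)) (faces_from p y).
Proof.
move=> pn; elim: k f y => [|k IH] f y vy /=.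
  by apply: vert_eq vy => t _ /=; rewrite addn0 if_same.
have pk : p + k <= (k + n).+1 by lia.
apply: vert_eq (IH _ _ (vert_face pk vy)) => t _ /=; congr f.
by rewrite /bump; case: ltnP; lia.
Qed.

Lemma vert_degens (X : sset) N (x : X N) f l n (y : X n) :
  degens_valid l n -> vert x f y ->
  vert x (f \o (fun t => t - count (fun j => j < t) l)) (degens l y).
Proof.
elim: l => [|j l IH] /=.
  by move=> _; apply: vert_eq => t _ /=; rewrite subn0.
move=> /degens_valid_cons [v jl lt] vy.
apply: vert_eq (vert_degen jl (IH v vy)) => t _ /=; congr f.
rewrite /unbump; case: (ltnP j t) => jt; last by rewrite subn0.
rewrite -subnDA; congr (_ - (_ + _)).
apply: eq_in_count => i il; have := lt _ il; lia.
Qed.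

(** The last-face operator restricts to vertices at most n - q, s_(m-1) repeats
    the vertex m - 1 = a, and the degeneracies at beta + m make the coordinate
    pause at the vertical steps. *)
Lemma vert_eml_left (X : sset) n (x : X n) p q (lt : p + q < n)
    (S : shuffle p.+1 q) :
  vert x (lpath (n - p - q - 1) (set_word (val S))) (eml_left lt S x).
Proof.
have cS : #|val S| = p.+1 by apply/eqP/(valP S).
have cC : #|~: val S| = q by have := cardsC (val S); rewrite cS card_ord; lia.
apply: vert_castx.
have v : degens_valid (shift_set (~: val S) (n - p - q)) (n - q).+1.
  by apply: shift_set_valid; rewrite cC; lia.
have h1 : n - q + 1 <= (n - q).+1 by lia.
have h2 : n - p - q - 1 <= n - q by lia.
have := vert_castx (eml_dim_faces_left lt S) (vert_id x).
move=> /(vert_faces_from h1) /(vert_degen h2) /(vert_degens v).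
apply: vert_eq => t; rewrite size_shift_set cC => tn.
rewrite /= count_shift_set set_wordC -map_take count_map.
set w := set_word _; have sw : size w = p.+1 + q by apply: size_set_word.
rewrite -[count _ (take _ w)]/(count negb (take (t - (n - p - q)) w)) /lpath.
have [ta|ta] := ltnP t (n - p - q).
  have -> : t - (n - p - q) = 0 by lia.
  rewrite take0 /= subn0 /unbump; have -> : t - (n - p - q - 1).+1 = 0 by lia.
  rewrite take0 /= (_ : (_ < t) = false) /=; last by lia.
  by rewrite subn0 ifT; lia.
have -> : (n - p - q - 1).+1 = n - p - q by lia.
have := count_id_negb (take (t - (n - p - q)) w).
rewrite size_takel ?sw; last by lia.
have : count id (take (t - (n - p - q)) w) <= p.+1.
  rewrite -cS -count_set_word -/w.
  rewrite -[in leqRHS](cat_take_drop (t - (n - p - q)) w).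
  by rewrite count_cat leq_addr.
by move=> c_id c_sum; rewrite /unbump ifT; lia.
Qed.

(** The deleted vertices m, ..., n - q - 1 are the ones passed by the jump, and
    the degeneracies at alpha + m make the coordinate pause at the horizontal
    steps. *)
Lemma vert_eml_right (X : sset) n (x : X n) p q (lt : p + q < n)
    (S : shuffle p.+1 q) :
  vert x (rpath (n - p - q - 1) (set_word (val S))) (eml_right lt S x).
Proof.
have cS : #|val S| = p.+1 by apply/eqP/(valP S).
apply: vert_castx.
have v : degens_valid (shift_set (val S) (n - p - q)) (n - p).
  by apply: shift_set_valid; rewrite cS; lia.
have h1 : n - p - q <= (n - p).+1 by lia.
have := vert_castx (eml_dim_faces_right lt S) (vert_id x).
move=> /(vert_faces_from h1) /(vert_degens v).
apply: vert_eq => t; rewrite size_shift_set cS => tn.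
rewrite /= count_shift_set.
set w := set_word _; have sw : size w = p.+1 + q by apply: size_set_word.
have cw : count id w = p.+1 by rewrite count_set_word.
rewrite /rpath cw.
have [ta|ta] := leqP t (n - p - q - 1).
  have -> : t - (n - p - q) = 0 by lia.
  by rewrite take0 /= subn0 ifT //; lia.
have -> : (n - p - q - 1).+1 = n - p - q by lia.
have := count_id_negb (take (t - (n - p - q)) w).
rewrite size_takel ?sw; last by lia.
by case: ifP; lia.
Qed.

End TermVertices.

(** * Summation over staircases *)

Section Reindexing.

Lemma sum_reindex_injective (I J : eqType) (V : nmodType)
    (s : seq I) (t : seq J) (phi : I -> J) (F : J -> V) :
  uniq s -> uniq t ->
  {in s &, injective phi} -> {in s, forall i, phi i \in t} ->
  (forall j, j \in t -> j \notin [seq phi i | i <- s] -> F j = 0) ->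
  \sum_(j <- t) F j = \sum_(i <- s) F (phi i).
Proof.
move=> us ut inj_phi sub F0; rewrite -(big_map phi xpredT F) /=.
rewrite (bigID (mem [seq phi i | i <- s])) /= [X in _ + X]big_seq_cond.
rewrite [X in _ + X]big1 ?addr0 => [|j /andP [jt /F0 -> //]].
rewrite -big_filter; apply/perm_big/uniq_perm; rewrite ?filter_uniq //.
  by rewrite map_inj_in_uniq.
move=> j; rewrite mem_filter; apply: andb_idr => /mapP [i si ->].
exact: sub.
Qed.

Definition words (T : finType) N : seq (seq T) :=
  [seq val t | t <- enum {: N.-tuple T}].

Lemma words_uniq (T : finType) N : uniq (words T N).
Proof. by rewrite map_inj_uniq ?enum_uniq //; apply: val_inj. Qed.

Lemma mem_words (T : finType) N (P : seq T) : (P \in words T N) = (size P == N).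
Proof.
apply/mapP/idP => [[t _ ->]|sz]; first by rewrite size_tuple.
by exists (Tuple sz); rewrite ?mem_enum.
Qed.

Definition staircases n : seq (nat * bitseq) :=
  [seq (a, P) | a <- iota 0 n.+1, P <- words bool (n - a)].

Lemma mem_staircases n i : (i \in staircases n) = (i.1 + size i.2 == n)%N.
Proof.
apply/allpairsPdep/idP => [[a [P [ai Pw ->]]]|].
  by move: ai Pw; rewrite mem_iota mem_words /=; lia.
case: i => a P /eqP h; rewrite /= in h; exists a, P.
by split=> //; rewrite ?mem_iota ?mem_words -h ?addKn //; lia.
Qed.

Lemma staircases_uniq n : uniq (staircases n).
Proof.
apply: allpairs_uniq_dep; first exact: iota_uniq.
  by move=> a _; apply: words_uniq.
by move=> [a P] [b Q] _ _ /= [-> ->].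
Qed.

Lemma nth_set_word N (A : {set 'I_N}) (i : 'I_N) :
  nth false (set_word A) i = (i \in A).
Proof. by rewrite (nth_map i) ?size_enum_ord ?nth_ord_enum. Qed.

Lemma sum_shuffles (V : nmodType) p q (F : bitseq -> V) :
  \sum_(S : shuffle p q) F (set_word (val S)) =
  \sum_(P <- words bool (p + q) | count id P == p) F P.
Proof.
rewrite -[RHS]big_filter -big_enum /=.
symmetry; apply: (@sum_reindex_injective _ _ _ (enum _) _
  (fun S : shuffle p q => set_word (val S))).
- exact: enum_uniq.
- by rewrite filter_uniq ?words_uniq.
- move=> S T _ _ e; apply/val_inj/setP => i.
  by rewrite -!nth_set_word e.
- move=> S _; rewrite mem_filter mem_words size_set_word eqxx andbT.
  by rewrite count_set_word (valP S).
move=> P; rewrite mem_filter mem_words => /andP [/eqP cP /eqP sP] /negP [].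
apply/mapP.
pose A := [set i : 'I_(p + q) | nth false P i].
have wA : set_word A = P.
  apply: (@eq_from_nth _ false); first by rewrite size_set_word.
  move=> i; rewrite size_set_word => ip.
  by rewrite (nth_set_word A (Ordinal ip)) inE.
have cA : #|A| == p by rewrite -count_set_word wA cP.
by exists (Sub A cA); rewrite ?mem_enum ?SubK.
Qed.

(** A word with p + 1 horizontal and q vertical letters, placed at
    a = n - p - q - 1, is a (p + 1, q)-shuffle; the words left out are those
    without a horizontal letter. *)
Lemma sum_staircases (V : nmodType) n (F : nat -> bitseq -> V) :
    (forall a P, (a + size P = n)%N -> ~~ has id P -> F a P = 0) ->
  \sum_(i <- staircases n) F i.1 i.2 =
  \sum_(q < n) \sum_(p < n - q) \sum_(S : shuffle p.+1 q)
    F (n - p - q - 1)%N (set_word (val S)).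
Proof.
move=> F0; rewrite big_allpairs_dep /=.
pose K a q := \sum_(P <- words bool (n - a) | count negb P == q) F a P.
have -> : \sum_(a <- iota 0 n.+1) \sum_(P <- words bool (n - a)) F a P =
    \sum_(a < n.+1) \sum_(q < n | (a + q < n)%N) K a q.
  rewrite -[iota 0 _]/(index_iota 0 n.+1) big_mkord; apply: eq_bigr => a _.
  (* split the words of a given length by their number of vertical letters *)
  rewrite /K (exchange_big_dep xpredT) //= big_seq [RHS]big_seq.
  apply: eq_bigr => P; rewrite mem_words => /eqP sP.
  have := count_id_negb P; rewrite sP => cP.
  have [hP|hP] := boolP (has id P).
    have lt : (count negb P < n)%N by move: hP; rewrite has_count; lia.
    rewrite (big_pred1 (Ordinal lt)) // => q /=.
    rewrite -val_eqE /= andbC eq_sym; apply: andb_idr => /eqP ->.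
    by move: hP; rewrite has_count; lia.
  by rewrite F0 ?big1 // sP; have := ltn_ord a; lia.
rewrite (exchange_big_dep xpredT) //=; apply: eq_bigr => q _.
have -> : \sum_(a < n.+1 | (a + q < n)%N) K a q = \sum_(a < n - q) K a q.
  rewrite (big_ord_widen n.+1 (K ^~ q)); last by lia.
  by apply: eq_bigl => a; lia.
(* for fixed q, the exponents p and a = n - q - 1 - p run in opposite order *)
rewrite (reindex_inj rev_ord_inj) /=; apply: eq_bigr => p _.
rewrite sum_shuffles /K.
have -> : (n - (n - q - p.+1) = p.+1 + q)%N by have := ltn_ord p; lia.
have -> : (n - q - p.+1 = n - p - q - 1)%N by lia.
rewrite big_seq_cond [RHS]big_seq_cond; apply: eq_bigl => P.
rewrite mem_words; apply: andb_id2l => /eqP sP.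
by have := count_id_negb P; rewrite sP; lia.
Qed.

End Reindexing.

Section Staircases.
Local Open Scope nat_scope.
Implicit Types (P : bitseq) (a n t : nat).

Lemma count_take_mono (T : Type) (p : pred T) (s : seq T) k l : k <= l ->
  count p (take k s) <= count p (take l s).
Proof.
move=> kl; rewrite -(take_takel s kl) -{2}(cat_take_drop k (take l s)).
by rewrite count_cat leq_addr.
Qed.

Lemma count_take_leq (T : Type) (p : pred T) (s : seq T) k :
  count p (take k s) <= count p s.
Proof. by rewrite -{2}(cat_take_drop k s) count_cat leq_addr. Qed.

Lemma lpath_diagonal a P t : t <= a -> lpath a P t = t.
Proof.
move=> ta; rewrite /lpath (_ : t - _ = 0); last by lia.
by rewrite take0 addn0; lia.
Qed.

Lemma rpath_diagonal a P t : t <= a -> rpath a P t = t.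
Proof. by rewrite /rpath => ->. Qed.

Lemma lpath_stair a P i : lpath a P (a.+1 + i) = a + count id (take i P).
Proof. by rewrite /lpath addKn; congr (_ + _); lia. Qed.

Lemma rpath_stair a P i :
  rpath a P (a.+1 + i) = a + count id P + count negb (take i P).
Proof. by rewrite /rpath addKn ifF //; lia. Qed.

Lemma lpath_mono a P t : lpath a P t <= lpath a P t.+1.
Proof.
by rewrite /lpath leq_add //; [lia | apply: count_take_mono; lia].
Qed.

Lemma lpath_le a P t : lpath a P t <= a + size P.
Proof.
rewrite /lpath leq_add ?geq_minr //.
exact: leq_trans (count_take_leq _ _ _) (count_size _ _).
Qed.

Lemma rpath_mono a P t : rpath a P t <= rpath a P t.+1.
Proof.
rewrite /rpath; case: (leqP t a) => ta; case: (leqP t.+1 a) => ta'; try lia.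
by rewrite leq_add2l; apply: count_take_mono; lia.
Qed.

Lemma rpath_le a P t : rpath a P t <= a + size P.
Proof.
rewrite /rpath -(count_id_negb P); case: (leqP t a) => ta; first by lia.
by rewrite addnA leq_add2l count_take_leq.
Qed.

End Staircases.

Section Step.
Variables (R : comPzRingType) (X Y : sset) (n : nat).
Implicit Types (i : nat * bitseq) (u : sprod X Y n).

Definition stair_over i u (v : sprod X Y n.+1) : Prop :=
  vert u.1 (lpath i.1 i.2) v.1 /\ vert u.2 (rpath i.1 i.2) v.2.

(** The simplex that the staircase i spans in u, which exists and is unique if
    i is one of the staircases of length n. *)
Definition step i u : sprod X Y n.+1 :=
  if pselect (exists v, stair_over i u v) is left h then sval (cid h)
  else degen 0 u.

Lemma stepP i u : i \in staircases n -> stair_over i u (step i u).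
Proof.
rewrite mem_staircases => /eqP hi; rewrite /step; case: pselect => [h|[]].
  exact: svalP.
have [v1 h1] := @vert_exists X n u.1 (lpath i.1 i.2) n.+1
  (fun t _ => lpath_mono _ _ t) (leq_trans (lpath_le _ _ _) (eq_leq hi)).
have [v2 h2] := @vert_exists Y n u.2 (rpath i.1 i.2) n.+1
  (fun t _ => rpath_mono _ _ t) (leq_trans (rpath_le _ _ _) (eq_leq hi)).
by exists (v1, v2).
Qed.

Lemma step_eq i u v : i \in staircases n -> stair_over i u v -> step i u = v.
Proof.
move=> /(stepP u) [h1 h2] [k1 k2].
rewrite [step i u]surjective_pairing [v]surjective_pairing.
by rewrite (vert_inj h1 k1) (vert_inj h2 k2).
Qed.

Definition stair_sign i : R := (-1) ^+ (i.1 + inversions i.2).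

Lemma ngen_repeated t k (v : sprod X Y k.+1) : (t <= k)%N ->
  v.1 = degen t (face t v.1) -> v.2 = degen t (face t v.2) -> ngen R v = 0.
Proof.
move=> tk e1 e2; apply: ngen_degenerate; exists t, (face t v); split=> //.
by rewrite [LHS]surjective_pairing e1 e2.
Qed.

Lemma eml_homotopyE u : eml_homotopy R X Y n (ngen R u) =
  \sum_(i <- staircases n) stair_sign i *: ngen R (step i u).
Proof.
rewrite /eml_homotopy /= nlift_gen.
pose F a P := stair_sign (a, P) *: ngen R (step (a, P) u).
rewrite (eq_bigr (fun i => F i.1 i.2)) => [|[a P] _ //].
(* without horizontal letters, positions a and a + 1 carry the same vertex *)
rewrite sum_staircases => [|a P hn hP]; last first.
  have hi : (a, P) \in staircases n by rewrite mem_staircases hn.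
  have [h1 h2] := stepP u hi.
  rewrite /F (@ngen_repeated a) ?scaler0 //; first by lia.
    apply: vert_repeated h1; first by lia.
    by rewrite lpath_diagonal // -(addn0 a.+1) lpath_stair take0 addn0.
  apply: vert_repeated h2; first by lia.
  rewrite rpath_diagonal // -(addn0 a.+1) rpath_stair take0 addn0.
  by move: hP; rewrite has_count /=; lia.
apply: eq_bigr => q _; apply: eq_bigr => p _; apply: eq_bigr => S _.
have lt := eml_index p.
have hi : ((n - p - q - 1)%N, set_word (val S)) \in staircases n.
  by rewrite mem_staircases /= size_set_word; apply/eqP; lia.
pose v := (eml_left (eml_index p) S u.1, eml_right (eml_index p) S u.2).
rewrite /F (@step_eq _ _ v) //; last first.
  by split; [apply: vert_eml_left | apply: vert_eml_right].
congr (_ *: _); rewrite /stair_sign /= -signr_odd -[RHS]signr_odd.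
congr ((-1) ^+ nat_of_bool _); rewrite !oddD -odd_shuffle_perm oddb.
congr (_ (+) _).
have : (0 < n - p - q)%N by lia.
by case: (n - p - q)%N => // k _; rewrite subn1 /= addbT negbK.
Qed.

End Step.

(** * Paths with two jumps *)

Section Letters.
Local Open Scope nat_scope.
Implicit Types (l : option bool) (T : seq (option bool)).

(** The letters x, y, z of the word T are [Some true], [Some false] and
    [None]. A word in x, y, z is the same as a shuffle of its z-letters with its
    xy-part, and also of its x-letters with its yz-part; both decompositions
    are used, one for each composite. *)
Definition isx l := l == Some true.
Definition isy l := l == Some false.
Definition isz l := l == None.

Definition yz_letter l : option bool :=
  match l with
  | Some true => None
  | Some false => Some true
  | None => Some false
  end.

Definition xy_steps T : bitseq := pmap id T.
Definition yz_steps T : bitseq := pmap yz_letter T.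

Lemma count_letters T : count isx T + count isy T + count isz T = size T.
Proof. by elim: T => //= -[[]|] T /=; lia. Qed.

Lemma count_id_xy T : count id (xy_steps T) = count isx T.
Proof. by elim: T => //= -[[]|] T /= ->. Qed.

Lemma count_negb_xy T : count negb (xy_steps T) = count isy T.
Proof. by elim: T => //= -[[]|] T /= ->. Qed.

Lemma count_id_yz T : count id (yz_steps T) = count isy T.
Proof. by elim: T => //= -[[]|] T /= ->. Qed.

Lemma count_negb_yz T : count negb (yz_steps T) = count isz T.
Proof. by elim: T => //= -[[]|] T /= ->. Qed.

Lemma size_xy T : size (xy_steps T) = count isx T + count isy T.
Proof. by rewrite -count_id_negb count_id_xy count_negb_xy. Qed.

Lemma size_yz T : size (yz_steps T) = count isy T + count isz T.
Proof. by rewrite -count_id_negb count_id_yz count_negb_yz. Qed.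

Lemma count_id_isSome T : count id (map isSome T) = count isx T + count isy T.
Proof. by elim: T => //= -[[]|] T /= ->; lia. Qed.

Lemma count_negb_isSome T : count negb (map isSome T) = count isz T.
Proof. by elim: T => //= -[[]|] T /= ->. Qed.

Lemma count_id_isx T : count id (map isx T) = count isx T.
Proof. by rewrite count_map. Qed.

Lemma count_negb_isx T : count negb (map isx T) = count isy T + count isz T.
Proof. by elim: T => //= -[[]|] T /= ->; lia. Qed.

(** A prefix of T cuts a prefix out of its xy-part, and similarly below. *)
Lemma take_xy T i :
  take (count isx (take i T) + count isy (take i T)) (xy_steps T) =
  xy_steps (take i T).
Proof.
by elim: T i => //= -[[]|] T IH [|i] /=; rewrite ?addnS ?take0 //= IH.
Qed.

Lemma take_yz T i :
  take (count isy (take i T) + count isz (take i T)) (yz_steps T) =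
  yz_steps (take i T).
Proof.
by elim: T i => //= -[[]|] T IH [|i] /=; rewrite ?addnS ?take0 //= IH.
Qed.

Lemma take_cat_add (A : Type) (s r : seq A) i :
  take (size s + i) (s ++ r) = s ++ take i r.
Proof. by rewrite take_cat ltnNge leq_addr addKn. Qed.

Lemma merge_inj T T' :
  map isSome T = map isSome T' -> xy_steps T = xy_steps T' -> T = T'.
Proof.
elim: T T' => [|l T IH] [|l' T'] //= [e es].
by case: l l' e => [b|] [b'|] //= _ => [[-> /IH ->]|/IH ->].
Qed.

Lemma merge_exists Q P : count id Q = size P ->
  exists T, map isSome T = Q /\ xy_steps T = P.
Proof.
elim: Q P => [|[] Q IH] [|b P] //=; first by exists [::].
- by move=> [/IH [T [<- <-]]]; exists (Some b :: T).
- by move=> /(IH [::]) [T [<- e]]; exists (None :: T).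
- by move=> /(IH (b :: P)) [T [<- e]]; exists (None :: T).
Qed.

End Letters.

Section Blocks.
Local Open Scope nat_scope.

(** A path (e, a, U, T) with two jumps. If e holds then z jumps first and y
    second; otherwise y and z jump together and z jumps once more. *)
Definition block := (bool * nat * bitseq * seq (option bool))%type.

(** The staircase of the operator that acts first comes first. *)
Definition staircase2 := ((nat * bitseq) * (nat * bitseq))%type.

(** The two staircases that produce the path in H_(XxY,Z) H_(X,YxZ). The second
    staircase shuffles z-steps with steps along the first one. As its vertical
    steps must all move z, the first staircase has to end with as many vertical
    steps as there are z-steps in the path; this is the block of [false].
    If z jumps first, the xy-steps of U are still on the diagonal of the first
    staircase, and its jump is the letter [true] between U and T. *)
Definition blockA (c : block) : staircase2 :=
  let: (e, a, U, T) := c in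
  if e then
    ((a + count id U, xy_steps T ++ nseq (count negb U + count isz T) false),
     (a, U ++ true :: map isSome T))
  else
    ((a, U ++ xy_steps T ++ nseq (count isz T) false),
     (a.+1 + size U, map isSome T)).

(** The two staircases that produce the path in H_(X,YxZ) H_(XxY,Z). The second
    staircase shuffles x-steps with steps along the first one. As its horizontal
    steps must all move x, the first staircase has to move x steadily on the
    stretch that they traverse. This stretch lies either in the word of the
    first staircase, as the block of [true], or on its diagonal; in the latter
    case the jump is the letter [false] between U and T. *)
Definition blockB (c : block) : staircase2 :=
  let: (e, a, U, T) := c in
  if e then
    ((a, U ++ nseq (count isx T) true ++ yz_steps T),
     (a.+1 + size U, map isx T))
  else
    ((a + size U + count isx T, yz_steps T),
     (a, U ++ false :: map isx T)).

Let counts := (count_cat, count_id_xy, count_negb_xy, count_id_yz,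
  count_negb_yz, count_id_isSome, count_negb_isSome, count_id_isx,
  count_negb_isx, count_nseq,
  size_cat, size_nseq, size_xy, size_yz, size_map).

Lemma lpath_stairE a P t i : t = a.+1 + i ->
  lpath a P t = a + count id (take i P).
Proof. by move=> ->; apply: lpath_stair. Qed.

Lemma rpath_stairE a P t i : t = a.+1 + i ->
  rpath a P t = a + count id P + count negb (take i P).
Proof. by move=> ->; apply: rpath_stair. Qed.

(** The two factorizations are compared on the three stretches of the path: the
    diagonal, the word U with the jump before it, and the word T with the
    second jump. *)
Lemma block_paths c t :
  let: (e, a, U, T) := c in t <= a + size U + size T + 2 ->
  let: ((a1, P1), (b1, Q1)) := blockA c in
  let: ((a2, P2), (b2, Q2)) := blockB c in
  [/\ lpath a1 P1 (lpath b1 Q1 t) = lpath a2 P2 (lpath b2 Q2 t),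
      rpath a1 P1 (lpath b1 Q1 t) = lpath a2 P2 (rpath b2 Q2 t) &
      rpath a1 P1 (rpath b1 Q1 t) = rpath a2 P2 (rpath b2 Q2 t)].
Proof.
case: c => [[[e a] U] T] ht.
have sU := count_id_negb U; have sT := count_letters T.
have [ta|ta] := leqP t a.
  have L a' P : a <= a' -> lpath a' P t = t.
    by move=> ?; apply: lpath_diagonal; lia.
  have S a' P : a <= a' -> rpath a' P t = t.
    by move=> ?; apply: rpath_diagonal; lia.
  by case: e => /=; split; rewrite !(L, S) //; lia.
have [tU|tU] := leqP t (a.+1 + size U).
  have [i iU et] : exists2 i, i <= size U & t = a.+1 + i.
    by exists (t - a.+1); lia.
  have xU := count_take_leq id U i; have yU := count_take_leq negb U i.
  have L P : lpath a (U ++ P) t = a + count id (take i U).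
    by rewrite (lpath_stairE _ et) takel_cat.
  have S P : rpath a (U ++ P) t =
      a + (count id U + count id P) + count negb (take i U).
    by rewrite (rpath_stairE _ et) takel_cat // count_cat.
  have L' P : lpath (a.+1 + size U) P t = t by rewrite lpath_diagonal.
  have S' P : rpath (a.+1 + size U) P t = t by rewrite rpath_diagonal.
  case: e; cbn [blockA blockB]; split; rewrite ?(L, S, L', S') ?counts.
  - by rewrite lpath_diagonal //; lia.
  - by rewrite rpath_diagonal //; lia.
  - rewrite (@rpath_stairE _ _ _ (size (xy_steps T) + count negb (take i U)));
      last by rewrite /= !counts; lia.
    by rewrite take_cat_add take_nseq ?counts /=; lia.
  - by rewrite lpath_diagonal //; lia.
  - by rewrite lpath_diagonal //= ?counts; lia.
  - by rewrite rpath_diagonal //= ?counts; lia.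
have [i iT et] : exists2 i, i <= size T & t = a.+1 + size U + i.+1.
  by exists (t - (a.+1 + size U).+1); lia.
have xT := count_take_leq isx T i; have yT := count_take_leq isy T i.
have zT := count_take_leq isz T i.
have et' : t = a.+1 + (size U + i.+1) by lia.
have et'' : t = (a.+1 + size U).+1 + i by lia.
have L b M : lpath a (U ++ b :: M) t =
    a + (count id U + (b + count id (take i M))).
  by rewrite (lpath_stairE _ et') take_cat_add count_cat.
have S b M : rpath a (U ++ b :: M) t =
    a + (count id U + (b + count id M)) +
      (count negb U + (~~ b + count negb (take i M))).
  by rewrite (rpath_stairE _ et') take_cat_add !count_cat.
have L' M : lpath (a.+1 + size U) M t = a.+1 + size U + count id (take i M).
  exact: lpath_stairE.
have S' M : rpath (a.+1 + size U) M t =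
    a.+1 + size U + count id M + count negb (take i M).
  exact: rpath_stairE.
have A u v : a.+1 + size U + u + v = a.+1 + size U + (u + v) by lia.
have K P j : lpath a (U ++ P) (a.+1 + size U + j) =
    a + count id U + count id (take j P).
  by rewrite -addnA lpath_stair take_cat_add count_cat addnA.
have N P j : rpath a (U ++ P) (a.+1 + size U + j) =
    a + count id U + count id P + (count negb U + count negb (take j P)).
  by rewrite -addnA rpath_stair take_cat_add !count_cat; lia.
have X1 r :
    take (count isx (take i T) + count isy (take i T)) (xy_steps T ++ r) =
    xy_steps (take i T).
  by rewrite takel_cat ?take_xy ?size_xy //; lia.
have X2 k j : j <= k ->
    take (count isx T + count isy T + j) (xy_steps T ++ nseq k false) =
    xy_steps T ++ nseq j false.
  by move=> jk; rewrite -size_xy take_cat_add take_nseq.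
have G1 r : take (count isx (take i T)) (nseq (count isx T) true ++ r) =
    nseq (count isx (take i T)) true.
  by rewrite takel_cat ?take_nseq ?size_nseq.
have G2 r j : take (count isx T + j) (nseq (count isx T) true ++ r) =
    nseq (count isx T) true ++ take j r.
  by rewrite -{1}(size_nseq (count isx T) true) take_cat_add.
case: e; cbn [blockA blockB]; split;
  rewrite ?(L, S, L', S') -?map_take !counts /=.
- rewrite (@lpath_stairE _ _ _ (count isx (take i T) + count isy (take i T)));
    last by lia.
  by rewrite K X1 G1 !counts; lia.
- rewrite (@rpath_stairE _ _ _ (count isx (take i T) + count isy (take i T)));
    last by lia.
  by rewrite A K X1 G2 take_yz !counts; lia.
- rewrite (@rpath_stairE _ _ _ (count isx T + count isy T +
    (count negb U + count isz (take i T)))); last by lia.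
  by rewrite A N X2 ?G2 ?take_yz ?counts /=; lia.
- by rewrite K X1 lpath_diagonal ?counts; lia.
- rewrite N X1.
  rewrite (@lpath_stairE _ _ _ (count isy (take i T) + count isz (take i T)));
    last by lia.
  by rewrite take_yz !counts /=; lia.
- rewrite (@rpath_stairE (a + _ + _) _ _
    (count isy (take i T) + count isz (take i T))); last by lia.
  by rewrite A N X2 ?take_yz ?counts /=; lia.
Qed.

Lemma inversions_cat P Q :
  inversions (P ++ Q) = inversions P + inversions Q + count negb P * count id Q.
Proof. by elim: P => [|[] P IH] /=; rewrite ?IH ?count_cat; nia. Qed.

Lemma inversions_nseq b k : inversions (nseq k b) = 0.
Proof. by elim: k => //= k ->; rewrite count_nseq; case: b. Qed.

(** Both sides count the pairs of letters of T that are out of the order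
    x < y < z. *)
Lemma inversions_letters T :
  inversions (xy_steps T) + inversions (map isSome T) =
  inversions (yz_steps T) + inversions (map isx T).
Proof.
elim: T => //= -[[]|] T IH /=.
- by rewrite -!IH; lia.
- by rewrite count_id_xy count_id_isx; lia.
- by rewrite count_id_isSome count_id_yz count_id_isx; lia.
Qed.

Definition degree (i : staircase2) : nat :=
  i.1.1 + inversions i.1.2 + (i.2.1 + inversions i.2.2).

(** The inversions within U, within T, and between the two agree on both sides.
    The starting points of the staircases, together with the inversions that
    involve the letter of the jump, account for an odd difference. *)
Lemma block_degrees c : odd (degree (blockA c)) = ~~ odd (degree (blockB c)).
Proof.
case: c => [[[e a] U] T]; have sU := count_id_negb U.
have iT := inversions_letters T.
rewrite -[~~ _]/(odd (degree _).+1).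
have [k e1] : exists k,
    degree (blockA (e, a, U, T)) + k.*2 = (degree (blockB (e, a, U, T))).+1.
  case: e; cbn [blockA blockB];
    rewrite /degree /= !inversions_cat /= !inversions_nseq !counts /=.
    (* here the degree of blockB exceeds that of blockA by exactly one *)
    by exists 1; rewrite !(mul0n, muln0, mul1n, muln1, mulnDr); lia.
  by exists (count isx T); rewrite !(mul0n, muln0, mul1n, muln1, mulnDr); lia.
by rewrite -e1 oddD odd_double addbF.
Qed.

Definition block_size (c : block) : nat :=
  let: (e, a, U, T) := c in a + size U + size T.

Definition blocks n : seq block := undup (flatten
  [seq [seq (ei, T) | ei <- [seq (e, i.1, i.2) | e <- enum {: bool},
                                                i <- staircases k],
                      T <- words (option bool) (n - k)] | k <- iota 0 n.+1]).

Lemma mem_blocks n c : (c \in blocks n) = (block_size c == n).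
Proof.
rewrite mem_undup; apply/flatten_mapP/idP => [[k]|].
  rewrite mem_iota => kn /allpairsP [[ei T] [/= hei hT ->]].
  case/allpairsP: hei => -[e [a U]] [_ /= + ->]; move: hT.
  by rewrite mem_staircases mem_words /= => /eqP hT /eqP hk; apply/eqP; lia.
case: c => [[[e a] U] T] /eqP h; rewrite /= in h.
exists (a + size U); first by rewrite mem_iota; lia.
apply/allpairsP; exists (e, a, U, T); rewrite mem_words; split=> //=.
  apply/allpairsP; exists (e, (a, U)).
  rewrite mem_staircases /= eqxx; split=> //.
  by rewrite mem_enum.
by apply/eqP; lia.
Qed.

Lemma blockA_staircases n c : c \in blocks n ->
  (blockA c).1 \in staircases n /\ (blockA c).2 \in staircases n.+1.
Proof.
rewrite mem_blocks !mem_staircases; case: c => [[[e a] U] T] /= /eqP h.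
have := count_id_negb U; have := count_letters T.
by case: e; cbn [blockA]; rewrite /= !counts /= ?counts => ? ?;
  split; apply/eqP; lia.
Qed.

Lemma blockB_staircases n c : c \in blocks n ->
  (blockB c).1 \in staircases n /\ (blockB c).2 \in staircases n.+1.
Proof.
rewrite mem_blocks !mem_staircases; case: c => [[[e a] U] T] /= /eqP h.
have := count_id_negb U; have := count_letters T.
by case: e; cbn [blockB]; rewrite /= !counts /= ?counts => ? ?;
  split; apply/eqP; lia.
Qed.

(** The place of the jump inside a word is found by counting one letter. *)
Lemma cat_cons_inj (p : pred bool) x (U U' M M' : bitseq) : p x ->
  count p U = count p U' -> U ++ x :: M = U' ++ x :: M' -> U = U' /\ M = M'.
Proof.
move=> px; elim: U U' => [|b U IH] [|b' U'] //=.
- by move=> _ [].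
- by move=> + [e _]; rewrite -e px.
- by move=> + [e _]; rewrite e px.
- by move=> + [e e']; rewrite -e => /addnI /IH /(_ e') [-> ->].
Qed.

Lemma cat_inj (A : eqType) (s s' r r' : seq A) : size s = size s' ->
  s ++ r = s' ++ r' -> s = s' /\ r = r'.
Proof. by move=> sz /eqP; rewrite eqseq_cat // => /andP [/eqP -> /eqP ->]. Qed.

Lemma merge_yz_inj T T' :
  map isx T = map isx T' -> yz_steps T = yz_steps T' -> T = T'.
Proof.
elim: T T' => [|l T IH] [|l' T'] //= [e es].
by case: l l' e => [[]|] [[]|] //= _; [|move=> []|move=> []] => /IH ->.
Qed.

Lemma merge_yz_exists Q P : count negb Q = size P ->
  exists T, map isx T = Q /\ yz_steps T = P.
Proof.
elim: Q P => [|[] Q IH] P /=; first by case: P => // _; exists [::].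
  by move=> /IH [T [<- <-]]; exists (Some true :: T).
case: P => // b P [/IH [T [<- <-]]].
by case: b; [exists (Some false :: T) | exists (None :: T)].
Qed.

Lemma blockA_inj : injective blockA.
Proof.
move=> [[[e a] U] T] [[[e' a'] U'] T'].
have sU := count_id_negb U; have sU' := count_id_negb U'.
case: e e' => [] [] /= [].
- move=> ea eP ea' eQ; rewrite -{}ea' in ea eP eQ *.
  have [eU eM] := cat_cons_inj (p := id) isT (addnI ea) eQ.
  rewrite -{}eU in eP *.
  have sT := congr1 (count id) eM; rewrite !count_id_isSome -!size_xy in sT.
  by have [/(merge_inj eM) ->] := cat_inj sT eP.
- by move=> <-; lia.
- by move=> ->; lia.
- move=> -> eP [/addnI sz] eM; have [-> {}eP] := cat_inj sz eP.
  have sT := congr1 (count id) eM; rewrite !count_id_isSome -!size_xy in sT.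
  by have [/(merge_inj eM) ->] := cat_inj sT eP.
Qed.

Lemma blockB_inj : injective blockB.
Proof.
move=> [[[e a] U] T] [[[e' a'] U'] T'].
have sU := count_id_negb U; have sU' := count_id_negb U'.
case: e e' => [] [] /= [].
- move=> -> eP [/addnI sz] eM; have [-> {}eP] := cat_inj sz eP.
  have sT := congr1 (count id) eM; rewrite !count_id_isx in sT.
  rewrite sT in eP.
  by have [_ /(merge_yz_inj eM) ->] := cat_inj erefl eP.
- by move=> e1 _ e2; lia.
- by move=> e1 _ e2; lia.
- move=> ea eP ea' eQ; rewrite -{}ea' in ea eQ *.
  have c1 := congr1 (count id) eQ; rewrite !count_cat /= !count_id_isx in c1.
  have [|-> eM] := @cat_cons_inj negb false _ _ _ _ isT _ eQ; first by lia.
  by rewrite (merge_yz_inj eM eP).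
Qed.

Lemma count_takeS (p : pred bool) Q i : i < size Q ->
  count p (take i.+1 Q) = count p (take i Q) + p (nth false Q i).
Proof. by move=> iQ; rewrite (take_nth false iQ) -cats1 count_cat /= addn0. Qed.

(** Finds the step at which a coordinate of a staircase leaves a given value. *)
Lemma nth_count (p : pred bool) Q j : j < count p Q ->
  exists i, [/\ i < size Q, p (nth false Q i) & count p (take i Q) = j].
Proof.
elim: Q j => //= b Q IH j; have [pb|pb] := boolP (p b); last first.
  by rewrite add0n => /IH [i [? ? ?]]; exists i.+1; rewrite /= (negPf pb).
case: j => [|j] /=; first by exists 0.
by rewrite add1n ltnS => /IH [i [? ? <-]]; exists i.+1; rewrite /= pb.
Qed.

Lemma lpath_step b Q i : i < size Q ->
  lpath b Q (b.+1 + i).+1 = lpath b Q (b.+1 + i) + nth false Q i.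
Proof. by move=> iQ; rewrite -addnS !lpath_stair count_takeS // addnA. Qed.

Lemma rpath_step b Q i : i < size Q ->
  rpath b Q (b.+1 + i).+1 = rpath b Q (b.+1 + i) + ~~ nth false Q i.
Proof. by move=> iQ; rewrite -addnS !rpath_stair count_takeS // addnA. Qed.

Lemma cat_nth_true Q i : i < size Q -> nth false Q i ->
  Q = take i Q ++ true :: drop i.+1 Q.
Proof.
by move=> iQ e; rewrite -{1}(cat_take_drop i Q) (drop_nth false iQ) e.
Qed.

Lemma cat_nth_false Q i : i < size Q -> ~~ nth false Q i ->
  Q = take i Q ++ false :: drop i.+1 Q.
Proof.
by move=> iQ /negPf e; rewrite -{1}(cat_take_drop i Q) (drop_nth false iQ) e.
Qed.

(** If the first staircase is not vertical on the stretch traversed by the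
    vertical steps of the second one, then one of these steps goes from j to
    j + 1 although r1 j = r1 (j + 1), while l2 rests; so all three coordinates
    rest. Otherwise the index is of the form [blockA c], with e telling whether
    the second staircase leaves its diagonal before the first one jumps. *)
Lemma blockA_or_repeats n a P b Q : a + size P = n -> b + size Q = n.+1 ->
  (exists2 c, c \in blocks n & blockA c = ((a, P), (b, Q))) \/
  exists2 t, t <= n.+1 &
    lpath b Q t = lpath b Q t.+1 /\
    rpath a P (rpath b Q t) = rpath a P (rpath b Q t.+1).
Proof.
move=> hP hQ; have cQ := count_id_negb Q; set k := count negb Q in cQ.
have [/andP [kP suffix]|not_suffix] :=
    boolP ((k <= size P) && ~~ has id (drop (size P - k) P)); last first.
  right; have [j [sj jn ej]] : exists j, [/\ b + count id Q <= j, j <= n &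
      rpath a P j = rpath a P j.+1].
    (* either a horizontal step lies on the stretch, or the stretch starts on
       the diagonal and P is vertical, so that the jump from a is trivial *)
    have [hd|nhd] := boolP (has id (drop (size P - k) P)).
      move: hd => /(has_nthP false) [e]; rewrite size_drop nth_drop => he.
      set e' := _ + e => e'P; exists (a.+1 + e'); split; try lia.
      by rewrite rpath_step ?e'P ?addn0 //; lia.
    have kP : size P < k by move: not_suffix; rewrite nhd andbT; lia.
    exists a; split; try lia.
    rewrite rpath_diagonal // -(addn0 a.+1) rpath_stair take0.
    move: nhd; rewrite (_ : size P - k = 0) ?drop0 ?has_count /=; lia.
  have [|i [iQ nQ ci]] := @nth_count negb Q (j - (b + count id Q)).
    by rewrite -/k; lia.
  exists (b.+1 + i); first by lia.
  rewrite lpath_step // (negPf nQ) addn0 rpath_step // nQ rpath_stair ci.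
  by rewrite subnKC // addn1 ej.
left; have eP : P = take (size P - k) P ++ nseq k false.
  rewrite -{1}(cat_take_drop (size P - k) P); congr (_ ++ _).
  rewrite (@all_pred1P _ false (drop _ P) _) ?size_drop ?subKn //.
  by rewrite -all_predC in suffix; apply: sub_all suffix => -[].
set P' := take _ P in eP.
have sP' : size P' = size P - k by rewrite size_takel; lia.
have [ba|ab] := leqP b a.
  have [|i [iQ nQ ci]] := @nth_count id Q (a - b); first by lia.
  have eQ := cat_nth_true iQ nQ.
  have := congr1 (count id) eQ; have := congr1 (count negb) eQ.
  rewrite !count_cat /= -/k => cn ci'.
  have [|T [eT eT']] := @merge_exists (drop i.+1 Q) P'; first by lia.
  exists (true, b, take i Q, T).
    rewrite mem_blocks /= -(size_map isSome T) eT size_drop size_takel; lia.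
  rewrite /= eT' eT -eQ -count_negb_isSome eT add0n in cn *.
  by rewrite -cn -eP ci subnKC.
have sU : b - a.+1 <= size P' by lia.
have [|T [eT eT']] := @merge_exists Q (drop (b - a.+1) P').
  by rewrite size_drop; lia.
exists (false, a, take (b - a.+1) P', T).
  rewrite mem_blocks /= -(size_map isSome T) eT size_takel; lia.
rewrite /= eT' eT -count_negb_isSome eT -/k catA cat_take_drop -eP.
rewrite size_takel //.
by rewrite subnKC.
Qed.

(** The same for the other composite: now l1 has to be injective on the stretch
    traversed by the horizontal steps of the second staircase, and this stretch
    must not contain the jump of the first one. *)
Lemma blockB_or_repeats n a P b Q : a + size P = n -> b + size Q = n.+1 ->
  (exists2 c, c \in blocks n & blockB c = ((a, P), (b, Q))) \/
  exists2 t, t <= n.+1 &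
    lpath a P (lpath b Q t) = lpath a P (lpath b Q t.+1) /\
    rpath b Q t = rpath b Q t.+1.
Proof.
move=> hP hQ; have cQ := count_id_negb Q; set m := count id Q in cQ.
have repeats j : b <= j < b + m -> lpath a P j = lpath a P j.+1 ->
    exists2 t, t <= n.+1 &
      lpath a P (lpath b Q t) = lpath a P (lpath b Q t.+1) /\
      rpath b Q t = rpath b Q t.+1.
  move=> hj ej; have [|i [iQ nQ ci]] := @nth_count id Q (j - b).
    by rewrite -/m; lia.
  exists (b.+1 + i); first by lia.
  rewrite lpath_step // rpath_step // nQ lpath_stair ci.
  by rewrite subnKC ?addn1 ?addn0 -?ej; lia.
have [ba|ab] := leqP b a.
  have [bma|abm] := leqP (b + m) a; last first.
    right; apply: (repeats a); first by lia.
    by rewrite lpath_diagonal // -(addn0 a.+1) lpath_stair take0 addn0.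
  left; have [|i [iQ nQ ci]] := @nth_count negb Q (a - b - m); first by lia.
  have eQ := cat_nth_false iQ nQ; have cU := count_id_negb (take i Q).
  have := congr1 (count id) eQ; have := congr1 (count negb) eQ.
  rewrite !count_cat /= -/m => cn cm.
  have [|T [eT eT']] := @merge_yz_exists (drop i.+1 Q) P; first by lia.
  exists (false, b, take i Q, T).
    rewrite mem_blocks /= -(size_map isx T) eT size_drop size_takel; lia.
  rewrite /= eT' eT -eQ -count_id_isx eT.
  by congr (_, _, _); lia.
have lt : b - a.+1 + m <= size P by lia.
have lt' : m <= size P - (b - a.+1) by lia.
have [ht|ht] := boolP (has negb (take m (drop (b - a.+1) P))).
  right; move: ht => /(has_nthP false) [e].
  rewrite size_takel ?size_drop; last by lia.
  move=> em; rewrite nth_take // nth_drop; set e' := _ + e => e'P.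
  apply: (repeats (a.+1 + e')); first by lia.
  by rewrite lpath_step ?(negPf e'P) ?addn0 //; lia.
left; have eP : P = take (b - a.+1) P ++ nseq m true ++ drop (b - a.+1 + m) P.
  rewrite -{1}(cat_take_drop (b - a.+1) P) -{1}(cat_take_drop m (drop _ P)).
  rewrite drop_drop [m + _]addnC; congr (_ ++ (_ ++ _)).
  rewrite (@all_pred1P _ true (take m _) _) ?size_takel ?size_drop //.
  by rewrite -all_predC in ht; apply: sub_all ht => -[].
have [|T [eT eT']] := @merge_yz_exists Q (drop (b - a.+1 + m) P).
  by rewrite size_drop; lia.
exists (true, a, take (b - a.+1) P, T).
  rewrite mem_blocks /= -(size_map isx T) eT size_takel; lia.
rewrite /= eT' eT -count_id_isx eT -/m -eP size_takel; last by lia.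
by rewrite subnKC.
Qed.

End Blocks.

(** * The two composites *)

Section Generators.
Variables (R : comPzRingType) (X : sset) (n : nat).

Lemma nchains_ext (V : lmodType R) (f g : {linear nchains R X n -> V}) :
  (forall x, f (ngen R x) = g (ngen R x)) -> f =1 g.
Proof.
move=> fg c.
have [d <-] : exists d, nclass d = c.
  by exists (generic_quotient.repr c); apply: nclass_repr.
have -> : nclass d = \sum_(x <- msupp d) d@_x *: ngen R x.
  rewrite [in LHS](monalgE d) (linear_sum (@nclass R X n)) /=.
  apply: eq_bigr => x _; rewrite -linearZ; congr nclass; apply/malgP => y.
  by rewrite fmcoeffZ !mcoeffU mulr_natr.
rewrite (linear_sum f) (linear_sum g); apply: eq_bigr => x _.
by rewrite !linearZ /= fg.
Qed.

End Generators.

Section TripleVertices.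
Variables X Y Z : sset.

Definition vert3 n (u : sprod3 X Y Z n) (f g h : nat -> nat)
    k (v : sprod3 X Y Z k) : Prop :=
  [/\ vert u.1.1 f v.1.1, vert u.1.2 g v.1.2 & vert u.2 h v.2].

Lemma vert_sprod (X' Y' : sset) n (u : sprod X' Y' n) f k (v : sprod X' Y' k) :
  vert u f v -> vert u.1 f v.1 /\ vert u.2 f v.2.
Proof.
move=> vuv; split.
  exact: (@spans_map (sprod X' Y') X' (fun _ x => x.1) _ _ _
    (fun _ _ _ => erefl) (fun _ _ _ => erefl) vuv).
exact: (@spans_map (sprod X' Y') Y' (fun _ x => x.2) _ _ _
  (fun _ _ _ => erefl) (fun _ _ _ => erefl) vuv).
Qed.

Definition step_XY_Z n i (u : sprod3 X Y Z n) : sprod3 X Y Z n.+1 :=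
  step (X := sprod X Y) (Y := Z) i u.

Definition step_X_YZ n i (u : sprod3 X Y Z n) : sprod3 X Y Z n.+1 :=
  sprodA X Y Z n.+1 (step (X := X) (Y := sprod Y Z) i (sprodAV X Y Z n u)).

Lemma step_XY_ZP n i (u : sprod3 X Y Z n) : i \in staircases n ->
  vert3 u (lpath i.1 i.2) (lpath i.1 i.2) (rpath i.1 i.2) (step_XY_Z i u).
Proof. by move=> /(stepP (X := sprod X Y) u) [/vert_sprod []]. Qed.

Lemma step_X_YZP n i (u : sprod3 X Y Z n) : i \in staircases n ->
  vert3 u (lpath i.1 i.2) (rpath i.1 i.2) (rpath i.1 i.2) (step_X_YZ i u).
Proof.
by move=> /(stepP (Y := sprod Y Z) (sprodAV X Y Z n u)) [? /vert_sprod []].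
Qed.

Lemma vert3_trans n (u : sprod3 X Y Z n) f g h k (v : sprod3 X Y Z k) f' g' h'
    l (w : sprod3 X Y Z l) :
  (forall t, [/\ f' t <= k, g' t <= k & h' t <= k])%N ->
  vert3 u f g h v -> vert3 v f' g' h' w ->
  vert3 u (f \o f') (g \o g') (h \o h') w.
Proof.
move=> le [uf ug uh] [vf vg vh].
by split;
  [apply: vert_trans uf vf | apply: vert_trans ug vg | apply: vert_trans uh vh];
  move=> t _; case: (le t).
Qed.

Lemma step_XY_Z_X_YZP n (u : sprod3 X Y Z n) i j :
    i \in staircases n -> j \in staircases n.+1 ->
  vert3 u (lpath i.1 i.2 \o lpath j.1 j.2) (rpath i.1 i.2 \o lpath j.1 j.2)
    (rpath i.1 i.2 \o rpath j.1 j.2) (step_XY_Z j (step_X_YZ i u)).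
Proof.
move=> hi hj; apply: vert3_trans (step_X_YZP u hi) (step_XY_ZP _ hj) => t.
by move: hj; rewrite mem_staircases => /eqP <-; rewrite !lpath_le rpath_le.
Qed.

Lemma step_X_YZ_XY_ZP n (u : sprod3 X Y Z n) i j :
    i \in staircases n -> j \in staircases n.+1 ->
  vert3 u (lpath i.1 i.2 \o lpath j.1 j.2) (lpath i.1 i.2 \o rpath j.1 j.2)
    (rpath i.1 i.2 \o rpath j.1 j.2) (step_X_YZ j (step_XY_Z i u)).
Proof.
move=> hi hj; apply: vert3_trans (step_XY_ZP u hi) (step_X_YZP _ hj) => t.
by move: hj; rewrite mem_staircases => /eqP <-; rewrite lpath_le !rpath_le.
Qed.

Lemma vert3_eq n (u : sprod3 X Y Z n) f g h f' g' h' k (v w : sprod3 X Y Z k) :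
  (forall t, (t <= k)%N -> [/\ f t = f' t, g t = g' t & h t = h' t]) ->
  vert3 u f g h v -> vert3 u f' g' h' w -> v = w.
Proof.
move=> e [uf ug uh] [vf vg vh].
rewrite [v]surjective_pairing [w]surjective_pairing.
rewrite [v.1]surjective_pairing [w.1]surjective_pairing.
congr ((_, _), _).
- by apply: vert_inj vf; apply: vert_eq uf => t /e [].
- by apply: vert_inj vg; apply: vert_eq ug => t /e [].
- by apply: vert_inj vh; apply: vert_eq uh => t /e [].
Qed.

Lemma vert3_repeated (R : comPzRingType) n (u : sprod3 X Y Z n) f g h k
    (v : sprod3 X Y Z k.+1) t :
  (t <= k)%N -> [/\ f t = f t.+1, g t = g t.+1 & h t = h t.+1] ->
  vert3 u f g h v -> ngen R v = 0.
Proof.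
move=> tk [ef eg eh] [uf ug uh]; apply: (@ngen_repeated R _ _ t) => //.
  rewrite [LHS]surjective_pairing.
  by rewrite (vert_repeated tk ef uf) (vert_repeated tk eg ug).
exact: vert_repeated uh.
Qed.

End TripleVertices.

Section SignedSum.
Variables (R : comPzRingType) (X Y Z : sset) (n : nat).

Lemma eml_XY_ZE k (u : sprod3 X Y Z k) : eml_XY_Z R X Y Z k (ngen R u) =
  \sum_(i <- staircases k) stair_sign R i *: ngen R (step_XY_Z i u).
Proof. exact: eml_homotopyE. Qed.

Lemma eml_X_YZE k (u : sprod3 X Y Z k) : eml_X_YZ R X Y Z k (ngen R u) =
  \sum_(i <- staircases k) stair_sign R i *: ngen R (step_X_YZ i u).
Proof.
rewrite /eml_X_YZ /= /nchains_map /= nlift_gen eml_homotopyE linear_sum /=.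
by apply: eq_bigr => i _; rewrite linearZ /= nlift_gen.
Qed.

(** Stated for an arbitrary parametrization phi, as it serves both
    composites. *)
Lemma sum_blocks (V : nmodType) (phi : block -> staircase2)
    (F : staircase2 -> V) :
  injective phi ->
  (forall c, c \in blocks n ->
     (phi c).1 \in staircases n /\ (phi c).2 \in staircases n.+1) ->
  (forall i j, i \in staircases n -> j \in staircases n.+1 ->
     (exists2 c, c \in blocks n & phi c = (i, j)) \/ F (i, j) = 0) ->
  \sum_(i <- staircases n) \sum_(j <- staircases n.+1) F (i, j) =
  \sum_(c <- blocks n) F (phi c).
Proof.
move=> inj_phi sub F0.
rewrite -(@big_allpairs _ _ _ _ _ (staircases n) (staircases n.+1) F).
apply: sum_reindex_injective.
- exact: undup_uniq.
- apply: allpairs_uniq; rewrite ?staircases_uniq //.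
  by move=> [? ?] [? ?] _ _ /= [-> ->].
- by move=> c c' _ _ /inj_phi.
- move=> c /sub [h1 h2]; apply/allpairsP; exists (phi c).
  by split=> //; case: (phi c).
move=> _ /allpairsP [[i j] [/= hi hj ->]] /mapP nin.
by case: (F0 i j hi hj) => // -[c hc ec]; case: nin; exists c.
Qed.

Lemma eml_anticommute_gen (u : sprod3 X Y Z n) :
  eml_XY_Z R X Y Z n.+1 (eml_X_YZ R X Y Z n (ngen R u)) =
  - eml_X_YZ R X Y Z n.+1 (eml_XY_Z R X Y Z n (ngen R u)).
Proof.
pose FA (x : staircase2) := (stair_sign R x.1 * stair_sign R x.2) *:
  ngen R (step_XY_Z x.2 (step_X_YZ x.1 u)).
pose FB (x : staircase2) := (stair_sign R x.1 * stair_sign R x.2) *: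
  ngen R (step_X_YZ x.2 (step_XY_Z x.1 u)).
have -> : eml_XY_Z R X Y Z n.+1 (eml_X_YZ R X Y Z n (ngen R u)) =
    \sum_(i <- staircases n) \sum_(j <- staircases n.+1) FA (i, j).
  rewrite eml_X_YZE linear_sum; apply: eq_bigr => i _.
  rewrite linearZ eml_XY_ZE /= scaler_sumr; apply: eq_bigr => j _.
  by rewrite scalerA.
have -> : eml_X_YZ R X Y Z n.+1 (eml_XY_Z R X Y Z n (ngen R u)) =
    \sum_(i <- staircases n) \sum_(j <- staircases n.+1) FB (i, j).
  rewrite eml_XY_ZE linear_sum; apply: eq_bigr => i _.
  rewrite linearZ eml_X_YZE /= scaler_sumr; apply: eq_bigr => j _.
  by rewrite scalerA.
rewrite (sum_blocks blockA_inj (@blockA_staircases n)); last first.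
  move=> [a P] [b Q] hi hj; have := step_XY_Z_X_YZP u hi hj.
  rewrite !mem_staircases /= in hi hj => vA.
  have [|[t tn [el er]]] := blockA_or_repeats (eqP hi) (eqP hj).
    by left.
  right.
  rewrite /FA (vert3_repeated R tn _ vA) ?scaler0 //=.
  by rewrite el er.
rewrite (sum_blocks blockB_inj (@blockB_staircases n)); last first.
  move=> [a P] [b Q] hi hj; have := step_X_YZ_XY_ZP u hi hj.
  rewrite !mem_staircases /= in hi hj => vB.
  have [|[t tn [el er]]] := blockB_or_repeats (eqP hi) (eqP hj).
    by left.
  right.
  rewrite /FB (vert3_repeated R tn _ vB) ?scaler0 //=.
  by rewrite el er.
rewrite -sumrN big_seq [RHS]big_seq; apply: eq_bigr => c hc.
have [hA1 hA2] := blockA_staircases hc; have [hB1 hB2] := blockB_staircases hc.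
have vA := step_XY_Z_X_YZP u hA1 hA2; have vB := step_X_YZ_XY_ZP u hB1 hB2.
rewrite /FA /FB (vert3_eq _ vA vB).
  rewrite -scaleNr /stair_sign -!exprD -signr_odd -[in RHS]signr_odd.
  rewrite -![(_ + _)%N]/(degree _) block_degrees.
  by case: (odd _); rewrite ?expr1 ?expr0 ?opprK.
move=> t tn; move: hc; rewrite mem_blocks => /eqP hc.
have := @block_paths c t; move: hc.
case: c {hA1 hA2 hB1 hB2 vA vB} => [[[e a] U] T] /= hc.
by case: e => /=; apply; lia.
Qed.

End SignedSum.

Theorem proposition3p4 (R : comPzRingType) (X Y Z : sset) (n : nat)
    (c : nchains R (sprod3 X Y Z) n) :
  eml_XY_Z R X Y Z n.+1 (eml_X_YZ R X Y Z n c) =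
  - eml_X_YZ R X Y Z n.+1 (eml_XY_Z R X Y Z n c).
Proof.
pose f : {linear _ -> _} := eml_XY_Z R X Y Z n.+1 \o eml_X_YZ R X Y Z n.
pose g : {linear _ -> _} := \- (eml_X_YZ R X Y Z n.+1 \o eml_XY_Z R X Y Z n).
exact: (@nchains_ext _ _ _ _ f g (@eml_anticommute_gen R X Y Z n)).
Qed.
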